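(* Let $0<k<1$ and let $w$ be a real number such that $w/K$ is irrational. Consider either of the following two cases. (cn case) $a_{2n}=\mathrm{cn}(w(2n+1))$, $a_{2n+1}=-\mathrm{dn}(w(2n+2))$ for $n\ge0$, with $$x_s=\cos\Bigl(\frac{\pi w(s-1/2)}{2K}\Bigr),\qquad \rho_s=\frac{\pi}{kK}\,\frac{1}{q^{s-1/2}+q^{-s+1/2}},\qquad s\in\mathbb{Z}.$$ (dn case) $a_{2n}=\mathrm{dn}(w(2n+1))$, $a_{2n+1}=-\mathrm{cn}(w(2n+2))$ for $n\ge0$, with $$x_s=\cos\Bigl(\frac{\pi ws}{2K}\Bigr),\qquad \rho_s=\frac{\pi}{K}\,\frac{1}{q^{s}+q^{-s}},\qquad s\in\mathbb{Z}.$$ Let $\Phi_n$ be the monic polynomials with reflection parameters $a_n$, and let $S_n$ be the associated symmetric polynomials on the interval, $$S_n(x)=\frac{z^{-n/2}\Phi_n(z)+z^{n/2}\Phi_n(1/z)}{2^n(1-a_{n-1})},\qquad x=\tfrac12(z^{1/2}+z^{-1/2}).$$ Then, in each case, for all $n,m=0,1,2,\dots$, $$\sum_{s=-\infty}^{\infty}\frac{S_n(x_s)S_m(x_s)+S_n(-x_s)S_m(-x_s)}{2}\,\rho_s=\kappa_n\,\delta_{nm},$$ and the set of points $x_s$, $s\in\mathbb{Z}$, is dense in $[-1,1]$.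
   Context: The functions $\mathrm{sn},\mathrm{cn},\mathrm{dn}$ are the Jacobi elliptic functions with modulus $k$. $K=K(k)$ is the complete elliptic integral of the first kind, $K'=K(k')$ with $k'^2=1-k^2$, and $q=\exp(-\pi K'/K)$. The monic polynomials with real reflection parameters $a_n$ are defined by $\Phi_0(z)=1$ and $\Phi_{n+1}(z)=z\Phi_n(z)-a_n z^n\Phi_n(1/z)$, $n\ge0$; by convention $a_{-1}=-1$. The functions $S_n(x)$ are monic polynomials of degree $n$ in $x$ with $S_n(-x)=(-1)^nS_n(x)$; in the formula for $S_n$ one takes $z^{\pm1/2}=e^{\pm i\theta/2}$ when $z=e^{i\theta}$, so that $x=\cos(\theta/2)$. The normalization constants are $\kappa_0=1$ and $\kappa_n=v_1v_2\cdots v_n$, where $v_1=(1+a_0)/2$ and $v_n=\frac14(1+a_{n-1})(1-a_{n-2})$ for $n\ge2$. *)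

(* Defs.v *)
From HB Require Import structures.
From mathcomp Require Import all_boot all_order all_algebra.
From mathcomp Require Import all_classical all_reals all_analysis.
From mathcomp Require Import complex ring.
Set Implicit Arguments.
Unset Strict Implicit.
Unset Printing Implicit Defensive.
Import Order.TTheory GRing.Theory Num.Theory.
Import numFieldNormedType.Exports.
Local Open Scope classical_set_scope.
Local Open Scope ring_scope.
Local Open Scope complex_scope.

Section Elliptic.
Variable R : realType.
Implicit Types k phi u t : R.

Definition ellipticF k phi : R :=
  let f t := (Num.sqrt (1 - k ^+ 2 * sin t ^+ 2))^-1 in
  if 0 <= phi then \int[lebesgue_measure]_(t in `[0, phi]) f t
  else - \int[lebesgue_measure]_(t in `[phi, 0]) f t.

Definition ellipticK k : R := ellipticF k (pi / 2).

Definition nome k : R :=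
  expR (- pi * ellipticK (Num.sqrt (1 - k ^+ 2)) / ellipticK k).

(* Jacobi amplitude on the real line: for [0 <= k < 1], [ellipticF k] is an
   increasing bijection of [R], and this is its inverse. *)
Definition jacobi_am k u : R := xget 0 [set phi | ellipticF k phi = u].

Definition jacobi_sn k u : R := sin (jacobi_am k u).
Definition jacobi_cn k u : R := cos (jacobi_am k u).
Definition jacobi_dn k u : R := Num.sqrt (1 - k ^+ 2 * jacobi_sn k u ^+ 2).

End Elliptic.

(* [recip n p] is [z ^ n * p (1 / z)]; see [horner_recip]. *)
Definition recip (R : nzRingType) (n : nat) (p : {poly R}) : {poly R} :=
  \poly_(i < n.+1) p`_(n - i).

Lemma horner_recip (F : fieldType) n (p : {poly F}) (z : F) :
  (size p <= n.+1)%N -> z != 0 -> (recip n p).[z] = z ^+ n * p.[z^-1].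
Proof.
move=> sp z0; rewrite horner_poly (horner_coef_wide _ sp) mulr_sumr.
rewrite (reindex_inj rev_ord_inj) /=; apply: eq_bigr => i _.
have i_n : (i <= n)%N by rewrite -ltnS.
by rewrite /= subSS subKn // mulrCA exprB ?unitfE // exprVn.
Qed.

Section Szego.
Variable R : realType.
Implicit Types (a : nat -> R) (n : nat) (theta x : R).

(* [a_{n-1}], with the convention [a_{-1} = -1] *)
Definition aprev a n : R := if n is m.+1 then a m else -1.

Fixpoint Phi a n : {poly R} :=
  if n is m.+1 then 'X * Phi a m - a m *: recip m (Phi a m) else 1.

Lemma size_Phi a n : (size (Phi a n) <= n.+1)%N.
Proof.
elim: n => [|n IH] /=; first by rewrite size_poly1.
apply: (leq_trans (size_polyD _ _)); rewrite size_polyN geq_max.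
apply/andP; split.
  by rewrite mulrC; apply: (leq_trans (size_polyMleq _ _)); rewrite size_polyX addn2.
by apply: (leq_trans (size_scale_leq _ _)); rewrite (leq_trans (size_poly _ _)).
Qed.

Definition expi theta : R[i] := cos theta +i* sin theta.

(* the right-hand side of the definition of [S_n (cos (theta / 2))], where
   [z = exp (i theta)] and [z ^ (1/2) = exp (i theta / 2)] *)
Definition szego_rhs a n theta : R[i] :=
  let z := expi theta in
  let z12 := expi (theta / 2) in
  let P := map_poly (real_complex R) (Phi a n) in
  (z12 ^- n * P.[z] + z12 ^+ n * P.[z^-1]) / (2 ^+ n * (1 - aprev a n)%:C).

Lemma expiD x y : expi (x + y) = expi x * expi y.
Proof.
by rewrite /expi cosD sinD; simpc; rewrite [in LHS](addrC (sin x * _)).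
Qed.

Lemma expi_neq0 x : expi x != 0.
Proof.
rewrite eq_complex /=; apply/negP => /andP[/eqP c0 /eqP s0].
by have := cos2Dsin2 x; rewrite c0 s0 expr0n addr0 => /eqP; rewrite eq_sym oner_eq0.
Qed.

Lemma expiN theta : expi (- theta) = (expi theta)^-1.
Proof.
apply: (mulIf (expi_neq0 theta)); rewrite -expiD addNr mulVf ?expi_neq0 //.
by rewrite /expi cos0 sin0.
Qed.

Lemma addcV x : expi x + (expi x)^-1 = (2 * cos x)%:C.
Proof.
rewrite -expiN; by apply/eqP; rewrite eq_complex /= cosN sinN subrr mulr_natl mulr2n !eqxx.
Qed.

Lemma chebyshev_ex n : exists p : {poly R}, forall x,
  (p.[cos x])%:C = expi x ^+ n + expi x ^- n.
Proof.
suff [p [_ [? _]]] : exists p q : {poly R},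
    (forall x, (p.[cos x])%:C = expi x ^+ n + expi x ^- n) /\
    (forall x, (q.[cos x])%:C = expi x ^+ n.+1 + expi x ^- n.+1).
  by exists p.
elim: n => [|n [p [q [pE qE]]]].
  exists 2%:P, (2 *: 'X); split => x.
    by rewrite hornerC !expr0 invr1 rmorph_nat.
  by rewrite hornerZ hornerX !expr1 addcV.
exists q, ((2 *: 'X) * q - p); split=> // x.
rewrite !hornerE rmorphB rmorphM /= pE qE -addcV -!exprVn.
have: expi x * (expi x)^-1 = 1 by rewrite divff ?expi_neq0.
move: (expi x) (expi x)^-1 => z y zy.
have -> : (z + y) * (z ^+ n.+1 + y ^+ n.+1) =
  z ^+ n.+2 + y ^+ n.+2 + z * y * (z ^+ n + y ^+ n) by rewrite !exprS; ring.
by rewrite zy mul1r addrK.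
Qed.

Lemma szego_ex a n : exists p : {poly R}, forall theta,
  (p.[cos (theta / 2)])%:C = szego_rhs a n theta.
Proof.
have H j : exists p : {poly R}, forall x, (p.[cos x])%:C =
    expi x ^- n * expi x ^+ j ^+ 2 + expi x ^+ n * (expi x ^- j) ^+ 2.
  have [nj|/ltnW jn] := leqP n (j * 2).
    have [p pE] := chebyshev_ex (j * 2 - n); exists p => x.
    have u : expi x \is a GRing.unit by rewrite unitfE expi_neq0.
    by rewrite pE exprB // exprVn -exprM mulrC invfM invrK.
  have [p pE] := chebyshev_ex (n - j * 2); exists p => x.
  have u : expi x \is a GRing.unit by rewrite unitfE expi_neq0.
  by rewrite pE exprB // exprVn -exprM addrC invfM invrK.
have [p pE] := @choice _ _ _ H.
exists ((2 ^+ n * (1 - aprev a n))^-1 *: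
  \sum_(j < n.+1) (Phi a n)`_j *: p j) => theta.
rewrite hornerZ horner_sum rmorphM /szego_rhs mulrC fmorphV rmorphM /= rmorphXn.
rewrite rmorph_nat; congr (_ / _).
rewrite rmorph_sum !(@horner_coef_wide _ n.+1) ?size_map_poly ?size_Phi //.
rewrite !mulr_sumr -big_split; apply: eq_bigr => j _ /=.
rewrite hornerZ rmorphM /= pE coef_map mulrDr !mulrA.
have -> : expi theta = expi (theta / 2) ^+ 2 by rewrite expr2 -expiD -splitr.
rewrite ![_ * (_ : R)%:C]mulrC -!exprVn -!exprM mulnC.
by congr (_ + _); rewrite exprM expr2 !mulrA.
Qed.

(* [S_n], the unique polynomial with the values prescribed by [szego_rhs]
   (which determine it on [-1, 1]) *)
Definition szegoS a n : {poly R} := sval (cid (szego_ex a n)).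

Lemma szegoSE a n theta : ((szegoS a n).[cos (theta / 2)])%:C = szego_rhs a n theta.
Proof. exact: (svalP (cid (szego_ex a n))). Qed.

(* [vcoef a n] is [v_n] for [n >= 1]; the value at [0] is never used *)
Definition vcoef a n : R :=
  match n with
  | 0 => 0
  | 1 => (1 + a 0) / 2
  | m.+2 => 4^-1 * (1 + a m.+1) * (1 - a m)
  end.

Definition kappa a n : R := \prod_(1 <= i < n.+1) vcoef a i.

(* sum over all integers: both one-sided series converge *)
Definition bilateral_sum (f : int -> R) (l : R) : Prop :=
  exists l1 l2 : R, [/\ series (fun s : nat => f s%:Z) @ \oo --> l1,
    series (fun s : nat => f (- (s.+1)%:Z)) @ \oo --> l2 & l = l1 + l2].

End Szego.

(* Main.v *)
Require Import Defs.
From HB Require Import structures.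
From mathcomp Require Import all_boot all_order all_algebra.
From mathcomp Require Import all_classical all_reals all_analysis.
From mathcomp Require Import complex ring lra zify.
Set Implicit Arguments.
Unset Strict Implicit.
Unset Printing Implicit Defensive.
Import Order.TTheory GRing.Theory Num.Theory.
Import numFieldNormedType.Exports.
Local Open Scope classical_set_scope.
Local Open Scope ring_scope.

(** The points x_s are the cosines of theta_s / 2, where theta_s = pi w (s + o) / K
with o = - 1/2 (cn case) or o = 0 (dn case), and the weights rho_s are the
Fourier coefficients of cn, resp. dn.  Hence
  sum over s of rho_s cos (j theta_s) = cn (j w), resp. dn (j w),
for every integer j: the measure carried by the points exp (i theta_s) has the
elliptic functions as trigonometric moments ([moment_cn], [moment_dn]).

Orthogonality on the circle is then algebra.  Write X for the moment function
and Psi_n u for the sum over j of Phi_n`_j X (u + j w).  The mixed addition formulas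
  cn (u + v) = cn u cn v - sn u sn v dn (u + v),
  dn (u + v) = dn u dn v - k^2 sn u sn v cn (u + v)
([cnD], [dnD]) turn the recurrence of the Phi_n, with the prescribed reflection
parameters, into the closed form
  Psi_n u = C_n sn u sn (u + w) ... sn (u + (n - 1) w) X_n (u + n w),
where X_n alternates between cn and dn ([Psi_prod]).  The zeros of the factors sn
say that Phi_n is orthogonal to 1, z, ..., z^(n-1).  Passing to the real
polynomials S_n is the classical Delsarte-Genin map ([pairing_lt], [pairing_eq],
[szego_orthogonal]); it needs a_n <> 1, which holds because w / K is irrational.

The Fourier coefficients are computed without contour integrals.  The real and
imaginary parts P and Q of dn (x + i y) are elementary in the amplitudes phi of x
(modulus k) and psi of K' - y (complementary modulus), and satisfy the
Cauchy-Riemann equations; therefore the integral over a period of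
exp (- lam (K' - y)) (P cos (lam x) + Q sin (lam x)) does not depend on y
([conservation]).  At y = 0 it is a Fourier coefficient of dn, up to the factor
exp (- lam K').  When y tends to K' the poles of dn are approached
and P becomes pi times a Dirac mass ([poisson_cvg]).  Comparing both ends for lam and - lam
gives pi / cosh (lam K') for the coefficient ([fourier_dn]); cn is treated in the same way
([fourier_cn]).  The Fourier series is summed by Fejer's kernel
([fourier_inversion]) at the points u = j w modulo 2 K; the irrationality of
w / K keeps them away from the ends of the period.  Both limits, at the pole and for
Fejer's kernel, are instances of one Korovkin-type lemma ([korovkin]).

Density of the x_s is Kronecker's theorem ([kronecker], [dense_cos_orbit]). *)

(** * Derivatives of explicit expressions *)

Section Calculus.
Variable R : realType.
Implicit Types (f g : R -> R) (x y a b c : R).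

Lemma derC c x : is_derive x (1 : R) (fun=> c) 0.
Proof. exact: is_derive_cst. Qed.

Lemma derI x : is_derive x (1 : R) (fun y : R => y) 1.
Proof. exact: is_derive_id. Qed.

Lemma derD f g x a b : is_derive x (1 : R) f a -> is_derive x (1 : R) g b ->
  is_derive x (1 : R) (fun y => f y + g y) (a + b).
Proof. by move=> df dg; apply: is_deriveD. Qed.

Lemma derN f x a : is_derive x (1 : R) f a -> is_derive x (1 : R) (fun y => - f y) (- a).
Proof. by move=> df; apply: is_deriveN. Qed.

Lemma derM f g x a b : is_derive x (1 : R) f a -> is_derive x (1 : R) g b ->
  is_derive x (1 : R) (fun y => f y * g y) (f x * b + g x * a).
Proof. by move=> df dg; apply: is_deriveM. Qed.

Lemma derX f n x a : is_derive x (1 : R) f a ->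
  is_derive x (1 : R) (fun y => f y ^+ n.+1) (n.+1%:R * f x ^+ n * a).
Proof.
move=> df; have := is_deriveX n.+1 df.
by rewrite exprfctE.
Qed.

Lemma der_comp f g x a b : is_derive (g x) (1 : R) f a -> is_derive x (1 : R) g b ->
  is_derive x (1 : R) (fun y => f (g y)) (a * b).
Proof. by move=> df dg; apply: (is_derive1_comp df dg). Qed.

Lemma derV f x a : is_derive x (1 : R) f a -> f x != 0 ->
  is_derive x (1 : R) (fun y => (f y)^-1) (- a / f x ^+ 2).
Proof.
move=> df fx0; have [dfx <-] := df; split; first exact: derivableV.
rewrite deriveV// /GRing.scale /=; ring.
Qed.

Lemma der_continuous f f' : (forall x, is_derive x (1 : R) f (f' x)) -> continuous f.
Proof.
move=> df x; apply: differentiable_continuous.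
by apply/derivable1_diffP; have [] := df x.
Qed.

Lemma der_eq f x a b : is_derive x (1 : R) f a -> a = b -> is_derive x (1 : R) f b.
Proof. by move=> ? <-. Qed.

Lemma der_cst f : (forall x, is_derive x (1 : R) f 0) -> forall x y, f x = f y.
Proof. by move=> df x y; apply: is_derive_0_is_cst. Qed.

Lemma der_sin f x a : is_derive x (1 : R) f a ->
  is_derive x (1 : R) (fun y => sin (f y)) (cos (f x) * a).
Proof. by move=> df; apply: der_comp. Qed.

Lemma der_cos f x a : is_derive x (1 : R) f a ->
  is_derive x (1 : R) (fun y => cos (f y)) (- sin (f x) * a).
Proof. by move=> df; apply: der_comp. Qed.

Lemma der_exp f x a : is_derive x (1 : R) f a ->
  is_derive x (1 : R) (fun y => expR (f y)) (expR (f x) * a).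
Proof. by move=> df; apply: der_comp. Qed.

End Calculus.

(* A syntax-directed search for the derivative of a closed expression.  The premises
   are kept away from typeclass resolution, which would instantiate them first. *)
Ltac der := first [der_atom | lazymatch goal with
  | |- is_derive _ _ (fun _ => ?c) _ => exact: derC
  | |- is_derive _ _ (fun y => y) _ => exact: derI
  | |- is_derive _ _ (fun y => @?f y + @?g y) _ =>
      notypeclasses refine (@derD _ f g _ _ _ _ _); der
  | |- is_derive _ _ (fun y => - @?f y) _ => notypeclasses refine (@derN _ f _ _ _); der
  | |- is_derive _ _ (fun y => @?f y * @?g y) _ =>
      notypeclasses refine (@derM _ f g _ _ _ _ _); der
  | |- is_derive _ _ (fun y => @?f y ^+ ?n.+1) _ =>
      notypeclasses refine (@derX _ f n _ _ _); der
  | |- is_derive _ _ (fun y => (@?f y)^-1) _ =>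
      notypeclasses refine (@derV _ f _ _ _ _); [der | ]
  | |- is_derive _ _ (fun y => sin (@?f y)) _ =>
      notypeclasses refine (@der_sin _ f _ _ _); der
  | |- is_derive _ _ (fun y => cos (@?f y)) _ =>
      notypeclasses refine (@der_cos _ f _ _ _); der
  | |- is_derive _ _ (fun y => expR (@?f y)) _ =>
      notypeclasses refine (@der_exp _ f _ _ _); der
  | |- is_derive _ _ (fun y => ?f (@?g y)) _ =>
      notypeclasses refine (@der_comp _ f g _ _ _ _ _); [der_atom | der]
  | |- _ => idtac
  end]
with der_atom := solve [eassumption | match goal with
  H : forall x, is_derive x _ ?f _ |- is_derive _ _ ?f _ => exact: H end].

Ltac derive := notypeclasses refine (der_eq _ _); [der | cbv beta ..].

(** * The elliptic integral and the real Jacobi functions *)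

Section Modulus.
Variables (R : realType) (k : R).
Hypotheses (k_gt0 : 0 < k) (k_lt1 : k < 1).
Implicit Types (t x : R).

Definition Delta t : R := Num.sqrt (1 - k ^+ 2 * sin t ^+ 2).

Lemma Delta_arg_gt0 t : 0 < 1 - k ^+ 2 * sin t ^+ 2.
Proof.
have := cos2Dsin2 t; have := sqr_ge0 (cos t); have := sqr_ge0 (sin t).
move: k_gt0 k_lt1; move: (cos t ^+2) (sin t ^+2) => c s; nra.
Qed.

Lemma Delta_gt0 t : 0 < Delta t.
Proof. by rewrite sqrtr_gt0 Delta_arg_gt0. Qed.

Lemma Delta_neq0 t : Delta t != 0.
Proof. by rewrite gt_eqF ?Delta_gt0. Qed.

Lemma Delta_sqr t : Delta t ^+ 2 = 1 - k ^+ 2 * sin t ^+ 2.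
Proof. by rewrite sqr_sqrtr// ltW// Delta_arg_gt0. Qed.

Lemma der_Delta t : is_derive t (1 : R) Delta (- k ^+ 2 * sin t * cos t / Delta t).
Proof.
have dsqrt := is_derive1_sqrt (Delta_arg_gt0 t).
rewrite /Delta; derive.
by rewrite -/(Delta t) /=; field; rewrite Delta_neq0.
Qed.

Lemma continuous_invDelta : continuous (fun t => (Delta t)^-1).
Proof.
apply: der_continuous => t.
by apply: derV (der_Delta t) _; exact: Delta_neq0.
Qed.

Local Notation mu := (@lebesgue_measure R).

Lemma continuous_integrable (f : R -> R) (a b : R) : continuous f ->
  mu.-integrable `[a, b] (EFin \o f).
Proof.
move=> cf; apply: continuous_compact_integrable; first exact: segment_compact.
exact: continuous_subspaceT.
Qed.

Local Notation F := (ellipticF k).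

(** With a base point to the left of both 0 and [x], the two-sided definition becomes a
    single integral with a variable upper end, to which the fundamental theorem applies. *)
Lemma ellipticF_shift a x : a < 0 -> a < x ->
  F x = \int[mu]_(t in `[a, x]) (Delta t)^-1 - \int[mu]_(t in `[a, 0]) (Delta t)^-1.
Proof.
move=> a0 ax; have ig u v := @continuous_integrable _ u v continuous_invDelta.
rewrite /ellipticF; case: (leP 0 x) => x0.
  rewrite (Rintegral_itvB (ig a x)) ?bnd_simp ?(ltW a0)//.
  by rewrite Rintegral_itv_obnd_cbnd//; apply: integrableS (ig 0 x) => //; exact: subset_itv_oc_cc.
rewrite -opprB (Rintegral_itvB (ig a 0)) ?bnd_simp ?(ltW ax) ?(ltW x0)//.
by rewrite Rintegral_itv_obnd_cbnd//; apply: integrableS (ig x 0) => //; exact: subset_itv_oc_cc.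
Qed.

Lemma der_ellipticF x : is_derive x (1 : R) F (Delta x)^-1.
Proof.
have [a a0 ax] : exists2 a : R, a < 0 & a < x.
  exists (- `|x| - 1); first by have := normr_ge0 x; lra.
  by have := ler_norm (- x); rewrite normrN; lra.
have xx1 : x < x + 1 by lra.
have [dI <-] := continuous_FTC1_closed xx1
  (@continuous_integrable _ a (x + 1) continuous_invDelta) ax (@continuous_invDelta x).
set G := (fun _ => _) in dI *.
pose c := \int[mu]_(t in `[a, 0]) (Delta t)^-1.
apply: (@near_eq_is_derive _ _ _ (fun x => G x - c)); last first.
  have dG : is_derive x (1 : R) G (derive1 G x) by rewrite derive1E; exact: DeriveDef.
  by derive; rewrite addr0.
near=> y; rewrite [RHS](@ellipticF_shift a)//.
by near: y; exact: lt_nbhsr.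
Unshelve. all: by end_near. Qed.

Lemma ellipticF0 : F 0 = 0.
Proof. by rewrite /ellipticF lexx set_itv1 Rintegral_set1. Qed.

Lemma ellipticFN x : F (- x) = - F x.
Proof.
apply/eqP; rewrite -addr_eq0; apply/eqP.
rewrite (@der_cst _ (fun x => F (- x) + F x) _ x 0); first by rewrite oppr0 ellipticF0 addr0.
move=> t; have dF := der_ellipticF; derive.
by rewrite /Delta sinN sqrrN; ring.
Qed.

Local Notation K := (ellipticK k).

Lemma ellipticF_pihalf : F (pi / 2) = K. Proof. by []. Qed.

Lemma ellipticFDpi x : F (x + pi) = F x + 2 * K.
Proof.
suff h : F (x + pi) - F x = 2 * K by rewrite -h; ring.
rewrite (@der_cst _ (fun x => F (x + pi) - F x) _ x (- (pi / 2))).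
  rewrite ellipticFN -/K /ellipticK (_ : - (pi / 2) + pi = pi / 2); last by lra.
  by rewrite ellipticF_pihalf; ring.
move=> t; have dF := der_ellipticF; derive.
by rewrite /Delta sinDpi sqrrN; ring.
Qed.

Lemma Delta_le1 t : Delta t <= 1.
Proof. by rewrite -sqrtr1 ler_wsqrtr// gerBl mulr_ge0 ?sqr_ge0. Qed.

(** The integrand is at least 1: this gives both the injectivity of [F] and its
    surjectivity onto the line. *)
Lemma ellipticF_ler x y : x <= y -> y - x <= F y - F x.
Proof.
move=> xy; have [||c _ ->] := @MVT_segment _ F (fun x => (Delta x)^-1) _ _ xy.
- by move=> c _; exact: der_ellipticF.
- exact/continuous_subspaceT/(der_continuous der_ellipticF).
by rewrite ler_peMl ?subr_ge0// invf_ge1 ?Delta_gt0// Delta_le1.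
Qed.

Lemma ellipticF_lt x y : x < y -> F x < F y.
Proof. by move=> xy; have := ellipticF_ler (ltW xy); lra. Qed.

Lemma ellipticF_inj : injective F.
Proof.
by move=> x y; case: (ltgtP x y) => // /ellipticF_lt; lra.
Qed.

Lemma ellipticF_surj u : exists x, F x = u.
Proof.
have [|||c _ <-] := @IVT _ F (- `|u|) `|u| u; last by exists c.
- by have := normr_ge0 u; lra.
- exact/continuous_subspaceT/(der_continuous der_ellipticF).
rewrite ellipticFN; have := @ellipticF_ler 0 `|u| (normr_ge0 u).
rewrite ellipticF0 !subr0 => h; have h2 := ler_norm u; have h3 := ler_norm (- u).
rewrite normrN in h3.
by rewrite ge_min le_max; apply/andP; split; apply/orP; [left|right]; lra.
Qed.

Local Notation am := (jacobi_am k).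

Lemma jacobi_amK u : F (am u) = u.
Proof. exact: (xgetPex 0 (ellipticF_surj u)). Qed.

Lemma ellipticFK x : am (F x) = x.
Proof. by apply: ellipticF_inj; rewrite jacobi_amK. Qed.

Lemma der_am u : is_derive u (1 : R) am (Delta (am u)).
Proof.
rewrite -{1}(jacobi_amK u) -[Delta _]invrK.
apply: (@is_derive_inverse _ F am _ (am u)).
- by near=> x; exact: ellipticFK.
- by near=> x; exact: (der_continuous der_ellipticF).
- exact: der_ellipticF.
- by rewrite invr_neq0 ?Delta_neq0.
Unshelve. all: by end_near. Qed.

Local Notation sn := (jacobi_sn k).
Local Notation cn := (jacobi_cn k).
Local Notation dn := (jacobi_dn k).

Lemma der_sn u : is_derive u (1 : R) sn (cn u * dn u).
Proof. exact: (der_sin (der_am u)). Qed.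

Lemma der_cn u : is_derive u (1 : R) cn (- sn u * dn u).
Proof. exact: (der_cos (der_am u)). Qed.

Lemma der_dn u : is_derive u (1 : R) dn (- k ^+ 2 * sn u * cn u).
Proof.
apply: der_eq; first exact: (der_comp (der_Delta (am u)) (der_am u)).
by rewrite divfK ?Delta_neq0.
Qed.

Lemma cn_sqr u : cn u ^+ 2 = 1 - sn u ^+ 2.
Proof. by rewrite /jacobi_cn cos2sin2. Qed.

Lemma dn_sqr u : dn u ^+ 2 = 1 - k ^+ 2 * sn u ^+ 2.
Proof. exact: Delta_sqr. Qed.

Lemma dn_gt0 u : 0 < dn u. Proof. exact: Delta_gt0. Qed.

Lemma am0 : am 0 = 0. Proof. by rewrite -{1}ellipticF0 ellipticFK. Qed.
Lemma amN u : am (- u) = - am u.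
Proof. by rewrite -{1}(jacobi_amK u) -ellipticFN ellipticFK. Qed.
Lemma amD2K u : am (u + 2 * K) = am u + pi.
Proof. by rewrite -{1}(jacobi_amK u) -ellipticFDpi ellipticFK. Qed.

Lemma sn0 : sn 0 = 0. Proof. by rewrite /jacobi_sn am0 sin0. Qed.
Lemma cn0 : cn 0 = 1. Proof. by rewrite /jacobi_cn am0 cos0. Qed.
Lemma dn0 : dn 0 = 1. Proof. by rewrite /jacobi_dn sn0 expr0n /= mulr0 subr0 sqrtr1. Qed.
Lemma snN u : sn (- u) = - sn u. Proof. by rewrite /jacobi_sn amN sinN. Qed.
Lemma cnN u : cn (- u) = cn u. Proof. by rewrite /jacobi_cn amN cosN. Qed.
Lemma dnN u : dn (- u) = dn u. Proof. by rewrite /jacobi_dn snN sqrrN. Qed.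
Lemma cnD2K u : cn (u + 2 * K) = - cn u. Proof. by rewrite /jacobi_cn amD2K cosDpi. Qed.
Lemma dnD2K u : dn (u + 2 * K) = dn u.
Proof. by rewrite /jacobi_dn /jacobi_sn amD2K sinDpi sqrrN. Qed.

End Modulus.

(** * Addition formulas *)

Section Addition.
Variables (R : realType) (k : R).
Hypotheses (k_gt0 : 0 < k) (k_lt1 : k < 1).
Implicit Types (u v c : R).
Local Notation sn := (jacobi_sn k).
Local Notation cn := (jacobi_cn k).
Local Notation dn := (jacobi_dn k).

Let addden u v := 1 - k ^+ 2 * sn u ^+ 2 * sn v ^+ 2.

Lemma addden_gt0 u v : 0 < addden u v.
Proof.
have := cn_sqr k u; have := sqr_ge0 (cn u); have := sqr_ge0 (sn u).
have := cn_sqr k v; have := sqr_ge0 (cn v); have := sqr_ge0 (sn v).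
rewrite /addden; move: (sn u ^+ 2) (sn v ^+ 2) (cn u ^+ 2) (cn v ^+ 2) => S T C D.
move=> T0 D0 eD S0 C0 eC.
have T1 : T <= 1 by lra.
have S1 : S <= 1 by lra.
have k2 : k ^+ 2 < 1 by rewrite expr_lt1// ltW.
have : S * T <= 1 by rewrite mulr_ile1.
have := sqr_ge0 k; have := mulr_ge0 S0 T0; rewrite -mulrA.
move: (S * T) (k ^+ 2) k2 => ST kk; nra.
Qed.

(** Along the line of pairs with sum [c] the quotient has derivative zero, and at
    [u = 0] it equals [cn c]. *)
Lemma cn_add_frac c u :
  (cn u * cn (c - u) - sn u * sn (c - u) * dn u * dn (c - u)) / addden u (c - u) = cn c.
Proof.
pose f u := (cn u * cn (c - u) - sn u * sn (c - u) * dn u * dn (c - u)) / addden u (c - u).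
rewrite -/(f u) (@der_cst _ f _ u 0).
  by rewrite /f /addden (cn0 k_gt0 k_lt1) (sn0 k_gt0 k_lt1) subr0; field; rewrite ?oner_eq0.
move=> {}u; rewrite /f /addden.
have dsn := der_sn k_gt0 k_lt1.
have dcn := der_cn k_gt0 k_lt1.
have ddn := der_dn k_gt0 k_lt1.
have E0 := addden_gt0 u (c - u).
derive; first by rewrite gt_eqF.
rewrite -/(addden u (c-u)).
have := cn_sqr k u; have := dn_sqr k_gt0 k_lt1 u.
have := cn_sqr k (c - u); have := dn_sqr k_gt0 k_lt1 (c - u).
move: E0; rewrite /addden.
move: (sn u) (cn u) (dn u) (sn (c - u)) (cn (c - u)) (dn (c - u)) => s1 c1 d1 s2 c2 d2.
move=> E0 D2 C2 D1 C1.

by field: D2 C2 D1 C1; rewrite !exprMn gt_eqF.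
Qed.

Lemma dn_add_frac c u :
  (dn u * dn (c - u) - k ^+ 2 * sn u * sn (c - u) * cn u * cn (c - u)) / addden u (c - u) = dn c.
Proof.
pose f u := (dn u * dn (c - u) - k ^+ 2 * sn u * sn (c - u) * cn u * cn (c - u)) / addden u (c - u).
rewrite -/(f u) (@der_cst _ f _ u 0).
  by rewrite /f /addden (dn0 k_gt0 k_lt1) (sn0 k_gt0 k_lt1) subr0; field; rewrite ?oner_eq0.
move=> {}u; rewrite /f /addden.
have dsn := der_sn k_gt0 k_lt1.
have dcn := der_cn k_gt0 k_lt1.
have ddn := der_dn k_gt0 k_lt1.
have E0 := addden_gt0 u (c - u).
derive; first by rewrite gt_eqF.
rewrite -/(addden u (c-u)).
have := cn_sqr k u; have := dn_sqr k_gt0 k_lt1 u.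
have := cn_sqr k (c - u); have := dn_sqr k_gt0 k_lt1 (c - u).
move: E0; rewrite /addden.
move: (sn u) (cn u) (dn u) (sn (c - u)) (cn (c - u)) (dn (c - u)) => s1 c1 d1 s2 c2 d2.
move=> E0 D2 C2 D1 C1.

by field: D2 C2 D1 C1; rewrite !exprMn gt_eqF.
Qed.

(** Substituting the two classical quotients for [cn (u + v)] and [dn (u + v)] makes
    this mixed form, with the sum on both sides, a rational identity. *)
Lemma cnD u v : cn (u + v) = cn u * cn v - sn u * sn v * dn (u + v).
Proof.
have := addden_gt0 u v => /lt0r_neq0 E0.
rewrite -[in LHS](cn_add_frac (u + v) u) -(dn_add_frac (u + v) u).
have -> : u + v - u = v by rewrite addrAC subrr add0r.
move: E0; rewrite /addden => E0.
have := cn_sqr k u; have := dn_sqr k_gt0 k_lt1 u.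
have := cn_sqr k v; have := dn_sqr k_gt0 k_lt1 v.
move: (sn u) (cn u) (dn u) (sn v) (cn v) (dn v) E0 => s1 c1 d1 s2 c2 d2.
move=> E0 D2 C2 D1 C1.
by field: D2 C2 D1 C1; rewrite !exprMn.
Qed.

Lemma dnD u v : dn (u + v) = dn u * dn v - k ^+ 2 * sn u * sn v * cn (u + v).
Proof.
have := addden_gt0 u v => /lt0r_neq0 E0.
rewrite -[in LHS](dn_add_frac (u + v) u) -(cn_add_frac (u + v) u).
have -> : u + v - u = v by rewrite addrAC subrr add0r.
move: E0; rewrite /addden => E0.
have := cn_sqr k u; have := dn_sqr k_gt0 k_lt1 u.
have := cn_sqr k v; have := dn_sqr k_gt0 k_lt1 v.
move: (sn u) (cn u) (dn u) (sn v) (cn v) (dn v) E0 => s1 c1 d1 s2 c2 d2.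
move=> E0 D2 C2 D1 C1.
by field: D2 C2 D1 C1; rewrite !exprMn.
Qed.

End Addition.

(** * Orthogonality on the unit circle *)

Section Opuc.
(* [S] is sn, [X false] is the moment function, cn or dn, and [X true] is the other one
   of the two; [XD] is the mixed addition formula, with [g b] equal to 1 or k^2. *)
Variables (R : realType) (S : R -> R) (X : bool -> R -> R) (g : bool -> R) (w : R).
Hypotheses (S0 : S 0 = 0) (SN : forall u, S (- u) = - S u).
Hypotheses (X0 : forall b, X b 0 = 1) (XN : forall b u, X b (- u) = X b u).
Hypothesis XD : forall b u v,
  X b (u + v) = X b u * X b v - g b * S u * S v * X (~~ b) (u + v).
Variable a : nat -> R.
Hypothesis aE : forall n, a n = (-1) ^+ n * X (odd n) (n.+1%:R * w).

(** The value at [Phi a n * z ^ (u / w)] of the functional whose moments are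
    [X false (j * w)]; the real exponent u / w makes the products of [Psi_prod] available. *)
Definition Psi n u : R := \sum_(j < n.+1) (Phi a n)`_j * X false (u + j%:R * w).

Lemma Phi_lead n : (Phi a n)`_n = 1.
Proof.
elim: n => [|n IH] /=; first by rewrite coef1.
by rewrite coefB coefXM /= IH coefZ coef_poly ltnn mulr0 subr0.
Qed.

Lemma Phi_const n : (Phi a n)`_0 = - aprev a n.
Proof.
case: n => [|n] /=; first by rewrite coef1 opprK.
by rewrite coefB coefXM /= coefZ coef_poly /= subn0 Phi_lead mulr1 sub0r.
Qed.

(** [X false] is even, so reversing the coefficients of [Phi a n] amounts to the
    substitution [u |-> - u - n * w]. *)
Lemma Psi_rec n u : Psi n.+1 u = Psi n (u + w) - a n * Psi n (- u - n%:R * w).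
Proof.
rewrite /Psi /=; under eq_bigr do rewrite coefB mulrBl.
rewrite big_split /=; congr (_ + _).
  rewrite big_ord_recl coefXM /= mul0r add0r; apply: eq_bigr => j _.
  by rewrite coefXM /= /bump add1n; congr (_ * X _ _); rewrite -natr1; ring.
rewrite sumrN; congr (- _).
rewrite big_ord_recr /= coefZ coef_poly ltnn mulr0 mul0r addr0 mulr_sumr.
rewrite [RHS](reindex_inj rev_ord_inj) /=; apply: eq_bigr => j _.
rewrite coefZ coef_poly ltn_ord subSS -mulrA; congr (_ * (_ * _)).
have jn : (j <= n)%N by rewrite -ltnS.
by rewrite -XN natrB//; congr (X _ _); ring.
Qed.

(** In the induction step the two terms of [Psi_rec] share the factors
    [S (u + i * w)] for [1 <= i <= n], and the addition formula with [v = n.+1 * w]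
    collapses what remains to a multiple of [S u * X _ (u + n.+1 * w)]: the reflection parameter is
    precisely the value that makes this happen. *)
Lemma Psi_prod n : exists C, forall u,
  Psi n u = C * (\prod_(i < n) S (u + i%:R * w)) * X (odd n) (u + n%:R * w).
Proof.
elim: n => [|n [C IH]].
  by exists 1 => u; rewrite /Psi big_ord1 big_ord0 coef1 /= !mul1r.
exists (- C * g (odd n) * S (n.+1%:R * w)) => u.
rewrite Psi_rec !IH aE /=.
have -> : \prod_(i < n) S (u + w + i%:R * w) = \prod_(i < n) S (u + i.+1%:R * w).
  by apply: eq_bigr => i _; congr S; rewrite -natr1; ring.
have -> : \prod_(i < n) S (- u - n%:R * w + i%:R * w) =
    (-1) ^+ n * \prod_(i < n) S (u + i.+1%:R * w).
  rewrite -[n in (-1) ^+ n]card_ord -prodrN.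
  rewrite [RHS](reindex_inj rev_ord_inj) /=; apply: eq_bigr => i _.
  rewrite -SN subnSK// natrB ?(ltnW (ltn_ord i))//; congr S; ring.
rewrite big_ord_recl /= mul0r addr0 subrK XN.
have -> : u + w + n%:R * w = u + n.+1%:R * w by rewrite -natr1; ring.
rewrite XD.
have e : ((-1) ^+ n) * ((-1) ^+ n) = 1 :> R by rewrite -expr2 sqrr_sign.
set P := \prod_(_ < _) _; set e1 := (-1) ^+ n in e *.
by ring: e.
Qed.

(** Orthogonality of [Phi a n] to the powers of z of degree below [n]. *)
Lemma Psi_zero n j : (j < n)%N -> Psi n (- (j%:R * w)) = 0.
Proof.
move=> jn; have [C ->] := Psi_prod n.
by rewrite (bigD1 (Ordinal jn))//= addNr S0 mul0r mulr0 mul0r.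
Qed.

(** The squared norm of [Phi a n]; the factor [1 - a n ^+ 2] comes from comparing
    the recurrence at [u = 0] and at [u = - n.+1 * w]. *)
Lemma Psi_end n : Psi n (- (n%:R * w)) = \prod_(i < n) (1 - a i ^+ 2).
Proof.
elim: n => [|n IH].
  by rewrite /Psi big_ord1 big_ord0 coef1 mul0r oppr0 addr0 X0 mulr1.
rewrite big_ord_recr /= -IH Psi_rec.
have := @Psi_zero n.+1 0 isT; rewrite Psi_rec.
have -> : - (0%:R * w) + w = w by ring.
have -> : - - (0%:R * w) - n%:R * w = - (n%:R * w) by ring.
move/eqP; rewrite subr_eq0 => /eqP h.
have -> : - (n.+1%:R * w) + w = - (n%:R * w) by rewrite -natr1; ring.
have -> : - - (n.+1%:R * w) - n%:R * w = w by rewrite -natr1; ring.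
by rewrite h; ring.
Qed.

Lemma kappaE n : kappa a n * (4 ^+ n * (1 - aprev a n)) = 2 * \prod_(i < n) (1 - a i ^+ 2).
Proof.
elim: n => [|n IH]; first by rewrite /kappa big_geq// big_ord0 /=; ring.
rewrite /kappa big_nat_recr//= -/(kappa a n) big_ord_recr /= [RHS]mulrA -IH.
by case: n {IH} => [|n] /=; [rewrite /kappa big_geq//|rewrite exprS]; field.
Qed.

(** The double sum obtained by applying the functional to the product of
    z^(-n/2) Phi_n(z) + z^(n/2) Phi_n(1/z) and its analogue of degree [m], up to a
    factor; here [n = m + 2 d]. *)
Definition pairing n m d : R := \sum_(i < n.+1) \sum_(j < m.+1) (Phi a n)`_i * (Phi a m)`_j *
  (2^-1 * (X false ((i%:Z + j%:Z - (m + d)%:Z)%:~R * w) + X false ((i%:Z - j%:Z - d%:Z)%:~R * w))).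

Lemma pairingE n m d : pairing n m d = 2^-1 * \sum_(j < m.+1) (Phi a m)`_j *
  (Psi n ((j%:R - (m + d)%:R) * w) + Psi n (- (j + d)%:R * w)).
Proof.
rewrite /pairing exchange_big /= mulr_sumr; apply: eq_bigr => j _.
rewrite /Psi -big_split !mulr_sumr; apply: eq_bigr => i _ /=.
have -> : (i%:Z + j%:Z - (m + d)%:Z)%:~R * w = (j%:R - (m + d)%:R) * w + i%:R * w.
  by rewrite rmorphB rmorphD /= -!pmulrn; ring.
have -> : (i%:Z - j%:Z - d%:Z)%:~R * w = - (j + d)%:R * w + i%:R * w.
  by rewrite !rmorphB /= natrD -!pmulrn; ring.
ring.
Qed.

(** All the arguments of [Psi n] in [pairingE] are among its zeros. *)
Lemma pairing_lt m d : pairing (m + d.+1.*2) m d.+1 = 0.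
Proof.
rewrite pairingE big1 ?mulr0// => j _.
have jm : (j <= m)%N by rewrite -ltnS.
have -> : (j%:R - (m + d.+1)%:R) * w = - ((m + d.+1 - j)%:R * w).
  by rewrite natrB ?(leq_trans jm) ?leq_addr//; ring.
have lt_mn : (m + d.+1 < m + d.+1.*2)%N by rewrite -addnn addnA -[X in (X < _)%N]addn0 ltn_add2l.
rewrite mulNr (Psi_zero (leq_ltn_trans (leq_subr j _) lt_mn)).
by rewrite Psi_zero ?addr0 ?mulr0// (leq_ltn_trans _ lt_mn)// leq_add2r.
Qed.

(** Only two terms avoid the zeros of [Psi n]: those of the constant coefficient
    [- aprev a n] and of the leading coefficient 1. *)
Lemma pairing_eq n :
  pairing n n 0 = 2^-1 * (1 - aprev a n) * \prod_(i < n) (1 - a i ^+ 2).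
Proof.
rewrite pairingE -Psi_end -mulrA; congr (_ * _).
under eq_bigr do rewrite mulrDr.
rewrite big_split /= mulrDl mul1r addrC; congr (_ + _).
  rewrite big_ord_recr /= big1 ?add0r => [|j _]; last first.
    by rewrite addn0 mulNr Psi_zero ?mulr0.
  by rewrite Phi_lead mul1r addn0 mulNr.
rewrite big_ord_recl /= big1 ?addr0 => [|j _]; last first.
  have -> : ((bump 0 j)%:R - (n + 0)%:R) * w = - ((n - j.+1)%:R * w).
    by rewrite natrB// addn0 /bump add1n; ring.
  by rewrite Psi_zero ?mulr0// ltn_subrL /= (leq_ltn_trans _ (ltn_ord j)).
by rewrite Phi_const addn0 sub0r !mulNr.
Qed.

End Opuc.

(** * From the circle to the interval *)

Section SzegoFormula.
Variable R : realType.
Implicit Types (a : nat -> R) (n : nat) (t : R).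

Lemma expiX t n : expi t ^+ n = expi (n%:R * t).
Proof.
elim: n => [|n IH]; first by rewrite expr0 mul0r /expi cos0 sin0.
by rewrite exprS IH -expiD -natr1; congr expi; ring.
Qed.

Lemma szegoS_cos a n t : (szegoS a n).[cos (t / 2)] =
  2 / (2 ^+ n * (1 - aprev a n)) *
  \sum_(j < n.+1) (Phi a n)`_j * cos ((j%:R - n%:R / 2) * t).
Proof.
apply: (@complexI R); rewrite szegoSE /szego_rhs.
have -> : 2 ^+ n * (1 - aprev a n)%:C%C = (2 ^+ n * (1 - aprev a n))%:C%C.
  by rewrite rmorphM /= rmorphXn rmorph_nat.
have -> : 2 / (2 ^+ n * (1 - aprev a n)) *
    \sum_(j < n.+1) (Phi a n)`_j * cos ((j%:R - n%:R / 2) * t) =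
  (\sum_(j < n.+1) (Phi a n)`_j * (2 * cos ((j%:R - n%:R / 2) * t))) /
    (2 ^+ n * (1 - aprev a n)).
  rewrite [LHS]mulrAC; congr (_ / _); rewrite mulr_sumr.
  by apply: eq_bigr => j _; rewrite mulrCA.
rewrite [RHS]rmorphM fmorphV; congr (_ / _); rewrite rmorph_sum /=.
rewrite !(@horner_coef_wide _ n.+1) ?size_map_poly ?size_Phi //.
rewrite -expiN !expiX -expiN !mulr_sumr -big_split /=.
apply: eq_bigr => j _; rewrite coef_map rmorphM /= -addcV -expiN !expiX.
rewrite mulrCA [X in _ + X]mulrCA -!expiD -mulrDr.
by congr (_ * (expi _ + expi _)); field.
Qed.

Lemma cosDnpi x n : cos (x + n%:R * pi) = (-1) ^+ n * cos x :> R.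
Proof.
elim: n => [|n IH]; first by rewrite mul0r addr0 mul1r.
by rewrite -natr1 mulrDl mul1r addrA cosDpi IH exprS mulN1r mulNr.
Qed.

(** Replacing x = cos (t / 2) by - x adds 2 pi to t. *)
Lemma szegoSN a n t : (szegoS a n).[- cos (t / 2)] = (-1) ^+ n * (szegoS a n).[cos (t / 2)].
Proof.
rewrite -cosDpi (_ : t / 2 + pi = (t + 2 * pi) / 2); last by field.
rewrite !szegoS_cos mulrCA; congr (_ * _); rewrite mulr_sumr.
apply: eq_bigr => j _; rewrite mulrCA; congr (_ * _).
have -> : (j%:R - n%:R / 2) * (t + 2 * pi) = (j%:R - n%:R / 2) * t - n%:R * pi + (2 * j)%:R * pi :> R.
  by rewrite natrM; field.
rewrite cosDnpi exprM sqrrN expr1n expr1n mul1r.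
rewrite -[cos ((_ - _) * t)](_ : cos ((j%:R - n%:R / 2) * t - n%:R * pi + n%:R * pi) = _); last first.
  by rewrite subrK.
by rewrite cosDnpi mulrA -expr2 sqrr_sign mul1r.
Qed.

End SzegoFormula.

Section BilateralSum.
Variable R : realType.
Implicit Types (f g : int -> R) (l m : R).

Lemma bilateral_sumD f g l m : bilateral_sum f l -> bilateral_sum g m ->
  bilateral_sum (fun s => f s + g s) (l + m).
Proof.
move=> [l1 [l2 [fl1 fl2 ->]]] [m1 [m2 [gm1 gm2 ->]]].
exists (l1 + m1), (l2 + m2); split; last by rewrite addrACA.
- rewrite (_ : series _ = series (fun s : nat => f s%:Z) \+ series (fun s : nat => g s%:Z)).
    exact: cvgD.
  by apply/funext => N; rewrite /series /= big_split.
- rewrite (_ : series _ = series (fun s : nat => f (- (s.+1)%:Z)) \+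
      series (fun s : nat => g (- (s.+1)%:Z))); first exact: cvgD.
  by apply/funext => N; rewrite /series /= big_split.
Qed.

Lemma bilateral_sumZ c f l : bilateral_sum f l -> bilateral_sum (fun s => c * f s) (c * l).
Proof.
move=> [l1 [l2 [fl1 fl2 ->]]]; exists (c * l1), (c * l2); split; last by rewrite mulrDr.
- rewrite (_ : series _ = c \*o series (fun s : nat => f s%:Z)); first exact: cvgMl_tmp.
  by apply/funext => N; rewrite /series /= mulr_sumr.
- rewrite (_ : series _ = c \*o series (fun s : nat => f (- (s.+1)%:Z))); first exact: cvgMl_tmp.
  by apply/funext => N; rewrite /series /= mulr_sumr.
Qed.

Lemma bilateral_sum0 : bilateral_sum (fun=> 0 : R) 0.
Proof.
exists 0, 0; rewrite addr0; split=> //.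
- rewrite (_ : series _ = cst 0); first exact: cvg_cst.
  by apply/funext => N; rewrite /series /= big1.
- rewrite (_ : series _ = cst 0); first exact: cvg_cst.
  by apply/funext => N; rewrite /series /= big1.
Qed.

Lemma bilateral_sum_sum n (f : 'I_n -> int -> R) (l : 'I_n -> R) :
  (forall i, bilateral_sum (f i) (l i)) ->
  bilateral_sum (fun s => \sum_(i < n) f i s) (\sum_(i < n) l i).
Proof.
elim: n f l => [|n IH] f l fl.
  by rewrite big_ord0; under eq_fun do rewrite big_ord0; exact: bilateral_sum0.
rewrite big_ord_recl; under eq_fun do rewrite big_ord_recl.
by apply: bilateral_sumD => //; apply: IH.
Qed.

Lemma eq_bilateral_sum f g l : f =1 g -> bilateral_sum f l -> bilateral_sum g l.
Proof. by move=> /funext ->. Qed.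

End BilateralSum.

Section Orthogonality.
Variables (R : realType) (S : R -> R) (X : bool -> R -> R) (g : bool -> R) (w : R).
Hypotheses (S0 : S 0 = 0) (SN : forall u, S (- u) = - S u).
Hypotheses (X0 : forall b, X b 0 = 1) (XN : forall b u, X b (- u) = X b u).
Hypothesis XD : forall b u v,
  X b (u + v) = X b u * X b v - g b * S u * S v * X (~~ b) (u + v).
Variable a : nat -> R.
Hypothesis aE : forall n, a n = (-1) ^+ n * X (odd n) (n.+1%:R * w).
Hypothesis a_neq1 : forall n, aprev a n != 1.
Variables (theta rho : int -> R).
Hypothesis moment : forall j : int,
  bilateral_sum (fun s => rho s * cos (j%:~R * theta s)) (X false (j%:~R * w)).

(** The product of two cosines is half the sum of the cosines of the sum and of the
    difference of the angles, which are integral multiples of [theta s] because the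
    degrees have the same parity. *)
Lemma bilateral_pairing m d : let n := (m + d.*2)%N in
  bilateral_sum (fun s => rho s *
    ((szegoS a n).[cos (theta s / 2)] * (szegoS a m).[cos (theta s / 2)]))
  (2 / (2 ^+ n * (1 - aprev a n)) * (2 / (2 ^+ m * (1 - aprev a m))) *
   pairing X w a n m d).
Proof.
move=> n; rewrite /pairing.
have nE : n%:R = m%:R + d%:R * 2 :> R by rewrite /n -muln2 natrD natrM.
set c := 2 / _; set c' := 2 / _.
apply: (@eq_bilateral_sum _ (fun s => c * c' * \sum_(i < n.+1) \sum_(j < m.+1)
  (Phi a n)`_i * (Phi a m)`_j * (2^-1 *
   (rho s * cos ((i%:Z + j%:Z - (m + d)%:Z)%:~R * theta s) +
    rho s * cos ((i%:Z - j%:Z - d%:Z)%:~R * theta s))))).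
  move=> s; rewrite !szegoS_cos -/c -/c'.
  have E A B : rho s * (c * A * (c' * B)) = c * c' * (rho s * (A * B)) by ring.
  rewrite E; congr (_ * _).
  rewrite mulr_suml mulr_sumr; apply: eq_bigr => i _.
  rewrite !mulr_sumr; apply: eq_bigr => j _.
  have -> : (i%:Z + j%:Z - (m + d)%:Z)%:~R * theta s =
      (i%:R - n%:R / 2) * theta s + (j%:R - m%:R / 2) * theta s :> R.
    by rewrite rmorphB rmorphD /= -!pmulrn nE ?natrD; field.
  have -> : (i%:Z - j%:Z - d%:Z)%:~R * theta s =
      (i%:R - n%:R / 2) * theta s - (j%:R - m%:R / 2) * theta s :> R.
    by rewrite !rmorphB /= -!pmulrn nE ?natrD; field.
  by rewrite cosD cosB; field.
apply: bilateral_sumZ; apply: bilateral_sum_sum => i; apply: bilateral_sum_sum => j.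
by apply: bilateral_sumZ; apply: bilateral_sumZ; apply: bilateral_sumD.
Qed.

(** The symmetrized summand vanishes identically when [n] and [m] have different
    parities, by [szegoSN]. *)
Lemma szego_orthogonal n m :
  bilateral_sum (fun s => ((szegoS a n).[cos (theta s / 2)] * (szegoS a m).[cos (theta s / 2)]
    + (szegoS a n).[- cos (theta s / 2)] * (szegoS a m).[- cos (theta s / 2)]) / 2 * rho s)
  (kappa a n * (n == m)%:R).
Proof.
wlog mn : n m / (m <= n)%N.
  move=> H; have [|/ltnW nm] := leqP m n; first exact: H.
  have -> : kappa a n * (n == m)%:R = kappa a m * (m == n)%:R.
    by rewrite eq_sym; case: eqP => [->|]; rewrite ?mulr0.
  by apply: eq_bilateral_sum (H m n nm) => s; rewrite ![(szegoS a m).[_] * _]mulrC.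
pose f s := rho s *
  ((szegoS a n).[cos (theta s / 2)] * (szegoS a m).[cos (theta s / 2)]).
apply: (@eq_bilateral_sum _ (fun s => (1 + (-1) ^+ (n + m)) / 2 * f s)).
  by move=> s; rewrite !szegoSN exprD /f; field.
have [d nE] : exists d, n = (m + d)%N by exists (n - m)%N; rewrite subnKC.
case: (boolP (odd (n + m))) => nm.
  rewrite -signr_odd nm expr1 subrr mul0r.
  apply: (@eq_bilateral_sum _ (fun=> 0)) => [s|]; first by rewrite mul0r.
  case: eqP => [nm'|_]; last by rewrite mulr0; exact: bilateral_sum0.
  by move: nm; rewrite nm' addnn odd_double.
rewrite -signr_odd (negbTE nm) expr0 (_ : (1 + 1) / 2 = 1 :> R); last by field.
apply: (@eq_bilateral_sum _ f) => [s|]; first by rewrite mul1r.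
have {}nE : n = (m + d./2.*2)%N.
  by rewrite {1}nE; congr (_ + _)%N; rewrite -[LHS]odd_double_half; 
    move: nm; rewrite nE addnAC addnn oddD odd_double /= => /negbTE ->.
have := @bilateral_pairing m d./2; rewrite /= -nE -/f.
case: (posnP d./2) nE => [->|].
  rewrite addn0 => nE; rewrite nE eqxx mulr1 (pairing_eq S0 SN X0 XN XD aE).
  rewrite (_ : _ * _ * _ = kappa a m)//.
  have h := kappaE a m.
  have n1 : 1 - aprev a m != 0 by rewrite subr_eq0 eq_sym.
  have n2 : 2 ^+ m != 0 :> R by rewrite expf_neq0.
  apply: (mulIf (mulf_neq0 (expf_neq0 m (_ : 4 != 0 :> R)) n1)) => //.
  rewrite h (_ : 4 = 2 ^+ 2 :> R); last by ring.
  by rewrite -exprM mulnC exprM; field; rewrite n1.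
case: (d./2) => // d' _ nE; rewrite nE (pairing_lt S0 SN XN XD aE) mulr0.
by rewrite -[X in (_ == X)%N]addn0 eqn_add2l /= mulr0.
Qed.

End Orthogonality.

(** * Conservation along imaginary translates *)

Lemma der_cont_at (R : realType) (f : R -> R) (x a : R) :
  is_derive x (1 : R) f a -> {for x, continuous f}.
Proof.
by move=> df; apply: differentiable_continuous; apply/derivable1_diffP; have [] := df.
Qed.

Ltac cont := let t := fresh "t" in move=> t; eapply der_cont_at; der.

Section Integral.
Variable R : realType.
Implicit Types (f g G : R -> R) (a b : R).
Local Notation mu := (@lebesgue_measure R).

Lemma Rintegral_FTC2 f G a b : a < b -> continuous f ->
  (forall x, is_derive x (1 : R) G (f x)) ->
  \int[mu]_(x in `[a, b]) f x = G b - G a.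
Proof.
move=> ab cf dG; rewrite /Rintegral (@continuous_FTC2 _ f G)//.
- exact: continuous_subspaceT.
- have cG := der_continuous dG; split.
  + by move=> x _; have [] := dG x.
  + exact: cvg_at_right_filter (cG a).
  + exact: cvg_at_left_filter (cG b).
- by move=> x _; rewrite derive1E; have [] := dG x.
Qed.

Lemma Rintegral_sum n (f : nat -> R -> R) a b : (forall i, continuous (f i)) ->
  \int[mu]_(x in `[a, b]) (\sum_(i < n) f i x) = \sum_(i < n) \int[mu]_(x in `[a, b]) f i x.
Proof.
move=> cf; elim: n => [|n IH].
  by under eq_Rintegral do rewrite big_ord0; rewrite big_ord0 Rintegral_cst// mul0r.
under eq_Rintegral do rewrite big_ord_recr.
rewrite big_ord_recr RintegralD ?IH//; apply: continuous_integrable => //.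
apply: continuous_big; first exact: add_continuous.
by move=> i _; exact: cf.
Qed.

End Integral.

Lemma Delta_ge (R : realType) (k t : R) : Num.sqrt (1 - k ^+ 2) <= Delta k t.
Proof.
by rewrite ler_wsqrtr// lerB// ler_piMr ?sqr_ge0// -[leRHS](cos2Dsin2 t) lerDr sqr_ge0.
Qed.

Section Conservation.
Variables (R : realType) (k : R).
Hypotheses (k_gt0 : 0 < k) (k_lt1 : k < 1).
Local Notation mu := (@lebesgue_measure R).
Local Notation F := (ellipticF k).
Local Notation K := (ellipticK k).
Local Notation k' := (Num.sqrt (1 - k ^+ 2)).
Local Notation F' := (ellipticF k').
Local Notation K' := (ellipticK k').

Lemma compl_gt0 : 0 < k'.
Proof. by rewrite sqrtr_gt0 subr_gt0 expr_lt1// ltW. Qed.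

Lemma compl_lt1 : k' < 1.
Proof. by rewrite -[ltRHS]sqrtr1 ltr_sqrt// gtrBl exprn_gt0. Qed.

(* [P1] and [Q1] are the derivatives of [P] and [Q] in [phi]; [dP2] and [dQ2] are the
   Cauchy-Riemann equations in the coordinates x = F phi and eta = F' psi. *)
Variables P Q P1 Q1 : R -> R -> R.
Hypothesis dP1 : forall psi, 0 < sin psi ->
  forall phi, is_derive phi (1 : R) (P ^~ psi) (P1 phi psi).
Hypothesis dQ1 : forall psi, 0 < sin psi ->
  forall phi, is_derive phi (1 : R) (Q ^~ psi) (Q1 phi psi).
Hypothesis dP2 : forall psi, 0 < sin psi -> forall phi,
  is_derive psi (1 : R) (P phi) (Delta k phi / Delta k' psi * Q1 phi psi).
Hypothesis dQ2 : forall psi, 0 < sin psi -> forall phi,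
  is_derive psi (1 : R) (Q phi) (- (Delta k phi / Delta k' psi * P1 phi psi)).
Hypothesis cP1 : forall psi, 0 < sin psi -> continuous (P1 ^~ psi).
Hypothesis cQ1 : forall psi, 0 < sin psi -> continuous (Q1 ^~ psi).
Hypothesis bP1 : forall d, 0 < d -> exists M, forall phi psi, d <= sin psi -> `|P1 phi psi| <= M.
Hypothesis bQ1 : forall d, 0 < d -> exists M, forall phi psi, d <= sin psi -> `|Q1 phi psi| <= M.

Variable lam : R.
Hypothesis boundary : forall psi,
  Q (pi / 2) psi * cos (lam * K) - P (pi / 2) psi * sin (lam * K) =
  Q (- (pi / 2)) psi * cos (lam * K) + P (- (pi / 2)) psi * sin (lam * K).

Let f psi phi := (P phi psi * cos (lam * F phi) + Q phi psi * sin (lam * F phi)) / Delta k phi.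
Let L psi := \int[mu]_(phi in `[- (pi / 2), pi / 2]) f psi phi.

Let df psi phi : 0 < sin psi -> is_derive psi (1 : R) (f ^~ phi)
  ((Q1 phi psi * cos (lam * F phi) - P1 phi psi * sin (lam * F phi)) / Delta k' psi).
Proof.
move=> s0; have := dP2 s0 phi; have := dQ2 s0 phi; rewrite /f => dQ dP.
derive; field; rewrite !Delta_neq0 ?compl_gt0 ?compl_lt1//.
Qed.

Let cf psi : 0 < sin psi -> continuous (f psi).
Proof.
move=> s0; have := dP1 s0; have := dQ1 s0; rewrite /f => dQ dP.
have dF := der_ellipticF k_gt0 k_lt1; have dD := der_Delta k_gt0 k_lt1.
by cont; exact: Delta_neq0.
Qed.

Let cross psi phi := Q1 phi psi * cos (lam * F phi) - P1 phi psi * sin (lam * F phi).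

Let ccross psi : 0 < sin psi -> continuous (cross psi).
Proof.
move=> s0; have cF : continuous F := der_continuous (der_ellipticF k_gt0 k_lt1).
have clF : continuous (fun phi => lam * F phi).
  by move=> x; apply: cvgMl_tmp; exact: cF.
move=> x; apply: cvgB; apply: cvgM.
- exact: cQ1.
- exact: (continuous_comp (clF x) (@continuous_cos _ _)).
- exact: cP1.
- exact: (continuous_comp (clF x) (@continuous_sin _ _)).
Qed.

Let int_cross psi : 0 < sin psi ->
  \int[mu]_(phi in `[- (pi / 2), pi / 2]) cross psi phi = lam * L psi.
Proof.
move=> s0; have cc := ccross s0; have cfp := cf s0.
have clf : continuous (fun phi => lam * f psi phi).
  by move=> x; apply: cvgMl_tmp; exact: cfp.
have pi0 : - (pi / 2) < pi / 2 :> R by have := pi_gt0 R; lra.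
have := @Rintegral_FTC2 _ (fun phi => cross psi phi - lam * f psi phi)
  (fun phi => Q phi psi * cos (lam * F phi) - P phi psi * sin (lam * F phi)) _ _ pi0.
rewrite RintegralB//; try exact: continuous_integrable.
rewrite RintegralZl//; last exact: continuous_integrable.
rewrite ellipticFN// ellipticF_pihalf mulrN cosN sinN mulrN opprK boundary subrr -/(L psi).
move=> H; apply/eqP; rewrite -subr_eq0; apply/eqP; apply: H.
  by move=> x; apply: cvgB; [exact: cc|exact: clf].
move=> phi; have := dP1 s0; have := dQ1 s0; have dF := der_ellipticF k_gt0 k_lt1.
by rewrite /cross /f => dQ dP; derive; field; rewrite Delta_neq0.
Qed.

(** Differentiation under the integral sign; by the Cauchy-Riemann equations the
    derivative of the integrand is, up to a multiple of the integrand itself, the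
    derivative in phi of Q cos (lam F) - P sin (lam F), whose end values agree by
    [boundary]. *)
Let dL psi : 0 < sin psi -> is_derive psi (1 : R) L (lam / Delta k' psi * L psi).
Proof.
move=> s0.
pose d := sin psi / 2.
have d0 : 0 < d by rewrite divr_gt0.
(* on a neighbourhood of psi the sine stays above d, which gives a uniform domination *)
have [u [v [Ipsi uv]]] : exists u v, (psi \in `]u, v[) /\ (forall x, x \in `]u, v[ -> d <= sin x).
  have : \forall x \near psi, d < sin x.
    by apply: (cvgr_gt (sin psi) (@continuous_sin R psi)); rewrite /d; lra.
  case/nbhs_ballP => e /= e0 He; exists (psi - e), (psi + e); split.
    by rewrite in_itv /=; apply/andP; split; lra.
  by move=> x; rewrite in_itv => xe; apply/ltW/He; rewrite /ball /= distrC ltr_distl.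
have [MP hMP] := bP1 d0; have [MQ hMQ] := bQ1 d0.
have D'0 x : 0 < Delta k' x by rewrite Delta_gt0 ?compl_gt0 ?compl_lt1.
pose c := Num.sqrt (1 - k' ^+ 2).
have c0 : 0 < c by rewrite sqrtr_gt0 subr_gt0 expr_lt1 ?compl_lt1// ltW// compl_gt0.
pose M := (`|MQ| + `|MP|) / c.
have M0 : 0 <= M by rewrite divr_ge0 ?addr_ge0// ltW.
have sx x : x \in `]u, v[ -> 0 < sin x by move=> /uv; apply: lt_le_trans.
pose I := `[- (pi / 2), pi / 2]%classic : set R.
have fE x phi : 0 < sin x -> partial1of2 f x phi = cross x phi / Delta k' x.
  by move=> sx0; rewrite /partial1of2 derive1E; have [_ <-] := df phi sx0.
have mI : measurable I by exact: measurable_itv.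
have intf x : `]u, v[%classic x -> mu.-integrable I (EFin \o f x).
  by move=> /= Ix; apply/continuous_integrable/cf/sx.
have derf x y : `]u, v[%classic x -> I y -> derivable (f ^~ y) x 1.
  by move=> /= Ix _; have [] := df y (sx x Ix).
have intM : mu.-integrable I (EFin \o cst M).
  by apply: continuous_integrable; exact: cst_continuous.
have ub x y : `]u, v[%classic x -> I y -> `|partial1of2 f x y| <= cst M y.
  move=> /= Ix _; rewrite fE ?sx// normrM normfV (gtr0_norm (D'0 x)) /M.
  rewrite ler_pM ?invr_ge0 ?(ltW (D'0 _))//; last first.
    by rewrite lef_pV2 ?posrE//; exact: Delta_ge.
  have hQ := le_trans (hMQ y _ (uv _ Ix)) (ler_norm _).
  have hP := le_trans (hMP y _ (uv _ Ix)) (ler_norm _).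
  have c1 z : `|cos z| <= 1 :> R by rewrite ler_norml cos_geN1 cos_le1.
  have s1 z : `|sin z| <= 1 :> R by rewrite ler_norml sin_geN1 sin_le1.
  rewrite (le_trans (ler_normB _ _))// !normrM lerD//.
    by rewrite -[leRHS]mulr1 ler_pM.
  by rewrite -[leRHS]mulr1 ler_pM.
have dLp := @derivable_under_integral R _ _ mu f I mI psi u v Ipsi intf derf (cst M)
  (fun=> M0) intM ub.
have eLp := @differentiation_under_integral R _ _ mu f I mI psi u v Ipsi intf derf (cst M)
  (fun=> M0) intM ub.
split; first exact: dLp.
rewrite -derive1E [LHS]eLp.
transitivity (\int[mu]_(phi in I) ((Delta k' psi)^-1 * cross psi phi)).
  by apply: eq_Rintegral => phi _; rewrite /= fE// mulrC.
rewrite RintegralZl//; last by apply/continuous_integrable/ccross.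
by rewrite int_cross// mulrA [_^-1 * _]mulrC.
Qed.

(** The function L exp (- lam F') has derivative zero on the interval from 0 to pi;
    psi = pi / 2 corresponds to the real line. *)
Lemma conservation psi : 0 < psi -> psi < pi ->
  \int[mu]_(phi in `[- (pi / 2), pi / 2])
    ((P phi psi * cos (lam * F phi) + Q phi psi * sin (lam * F phi)) / Delta k phi) =
  expR (lam * (F' psi - K')) * \int[mu]_(phi in `[- (pi / 2), pi / 2])
    ((P phi (pi / 2) * cos (lam * F phi) + Q phi (pi / 2) * sin (lam * F phi)) / Delta k phi).
Proof.
move=> psi0 psipi; rewrite -/(L psi) -/(L (pi / 2)).
have dF' := der_ellipticF compl_gt0 compl_lt1.
pose g x := expR (- (lam * F' x)) * L x.
have dg x : 0 < x -> x < pi -> is_derive x (1 : R) g 0.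
  move=> x0 xpi; have dLx := dL (sin_gt0_pi (introT andP (conj x0 xpi))).
  rewrite /g; derive; ring.
have gc x y : 0 < x -> y < pi -> x <= y -> g x = g y.
  move=> x0 ypi xy; apply/esym/eqP; rewrite -subr_eq0; apply/eqP.
  have [||c _ ->] := @MVT_segment _ g (fun=> 0) _ _ xy; last by rewrite mul0r.
    by move=> z; rewrite in_itv /= => /andP[xz zy]; apply: dg; lra.
  apply: derivable_within_continuous => z; rewrite in_itv /= => /andP[xz zy].
  by have [] : is_derive z (1 : R) g 0 by apply: dg; lra.
have pi0 := pi_gt0 R.
have : g psi = g (pi / 2).
  by case: (leP psi (pi / 2)) => h; [|apply/esym]; apply: gc; lra.
rewrite /g => /(congr1 (fun x => expR (lam * F' psi) * x)).
rewrite !mulrA -!expRD subrr expR0 mul1r => ->.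
by rewrite -/K' /ellipticK; congr (expR _ * _); ring.
Qed.

End Conservation.

(** * Approximate identities *)

Section Korovkin.
Variable R : realType.
Local Notation mu := (@lebesgue_measure R).
Variables (a b : R) (g h : R -> R) (g0 : R).
Hypotheses (ab : a <= b) (cg : continuous g) (ch : continuous h).
Hypotheses (h_ge0 : forall x, 0 <= h x)
  (h_eq0 : forall x, a <= x -> x <= b -> h x = 0 -> g x = g0).

Lemma korovkin_bound e : 0 < e ->
  exists2 C, 0 <= C & forall x, a <= x -> x <= b -> `|g x - g0| <= e + C * h x.
Proof.
move=> e0.
have cgg : continuous (fun x => `|g x - g0|).
  by move=> x; apply: cvg_norm; apply: cvgB; [exact: cg|exact: cvg_cst].
have [|x1 _ Mx1] := @EVT_max _ (fun x => `|g x - g0|) _ _ ab.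
  exact: continuous_subspaceT.
(* u is positive where h vanishes, so |u| + u + h has a positive minimum m, and
   h >= m wherever |g - g0| >= e *)
pose u x := e - `|g x - g0|.
have u0 x : 0 <= `|u x| + u x by have := ler_norm (- u x); rewrite normrN; lra.
have [|x2 x2ab mx2] := @EVT_min _ (fun x => `|u x| + u x + h x) _ _ ab.
  have cu : continuous u by move=> x; apply: cvgB; [exact: cvg_cst|exact: cgg].
  apply: continuous_subspaceT => x; apply: cvgD; last exact: ch.
  by apply: cvgD; [apply: cvg_norm|]; exact: cu.
set M := `|g x1 - g0| in Mx1; set m := `|u x2| + u x2 + h x2 in mx2.
have m0 : 0 < m.
  rewrite lt_neqAle addr_ge0// andbT eq_sym /m paddr_eq0//.
  apply/negP => /andP[/eqP m1 /eqP hx2].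
  move: x2ab; rewrite in_itv => /andP[ax2 x2b].
  move: m1; rewrite /u (h_eq0 ax2 x2b hx2) subrr normr0 subr0 (gtr0_norm e0); lra.
exists (M / m); first by rewrite divr_ge0 ?normr_ge0// ltW.
move=> x ax xb; have xab : x \in `[a, b] by rewrite in_itv /= ax.
case: (leP `|g x - g0| e) => [le_e|lt_e].
  by rewrite (le_trans le_e)// lerDl mulr_ge0// divr_ge0 ?normr_ge0// ltW.
have := mx2 _ xab; rewrite ler0_norm /u ?subr_le0 ?(ltW lt_e)// addNr add0r => mh.
rewrite (le_trans (Mx1 _ xab))// -[leLHS]add0r lerD ?(ltW e0)//.
by rewrite mulrAC ler_pdivlMr// ler_wpM2l// normr_ge0.
Qed.

(** A nonnegative kernel of mass [m] that annihilates [h] in the limit concentrates on the zeros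
    of [h], where [g] takes the single value [g0]. *)
Lemma korovkin (p : nat -> R -> R) m :
  (forall n, continuous (p n)) -> (forall n x, 0 <= p n x) ->
  (forall n, \int[mu]_(x in `[a, b]) p n x = m) ->
  (fun n => \int[mu]_(x in `[a, b]) (p n x * h x)) @ \oo --> (0 : R) ->
  (fun n => \int[mu]_(x in `[a, b]) (p n x * g x)) @ \oo --> m * g0.
Proof.
move=> cp p0 pm ph.
have m0 : 0 <= m by rewrite -(pm 0); apply: Rintegral_ge0.
have cph n : continuous (fun x => p n x * h x) by move=> x; apply: cvgM; [exact: cp|exact: ch].
have cpg n : continuous (fun x => p n x * g x) by move=> x; apply: cvgM; [exact: cp|exact: cg].
have ccst c n : continuous (fun x => c * p n x) by move=> x; apply: cvgMl_tmp; exact: cp.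
apply/cvgrPdist_le => e e0.
have e1 : 0 < e / 2 / (m + 1) by rewrite !divr_gt0// ltr_wpDl.
have [C C0 HC] := korovkin_bound e1.
have e2 : 0 < e / 2 / (C + 1) by rewrite !divr_gt0// ltr_wpDl.
have /cvgrPdist_le /(_ _ e2) := ph; apply: filterS => n.
rewrite sub0r normrN ger0_norm; last by apply: Rintegral_ge0 => x _; rewrite mulr_ge0.
move=> hn.
have -> : m * g0 - \int[mu]_(x in `[a, b]) (p n x * g x) =
    \int[mu]_(x in `[a, b]) (g0 * p n x - p n x * g x).
  rewrite RintegralB//; try exact: continuous_integrable.
  by rewrite RintegralZl// ?pm 1?mulrC//; exact: continuous_integrable.
have cd : continuous (fun x => g0 * p n x - p n x * g x).
  by move=> x; apply: cvgB; [exact: ccst|exact: cpg].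
apply: le_trans (le_normr_Rintegral _ _) _ => //; first exact: continuous_integrable.
have cu : continuous (fun x => e / 2 / (m + 1) * p n x + C * (p n x * h x)).
  by move=> x; apply: cvgD; [exact: ccst|apply: cvgMl_tmp; exact: cph].
apply: (@le_trans _ _ (\int[mu]_(x in `[a, b]) (e / 2 / (m + 1) * p n x + C * (p n x * h x)))).
  apply: le_Rintegral => //; try exact: continuous_integrable.
    by apply: continuous_integrable => x; apply: cvg_norm; exact: cd.
  move=> x /=; rewrite in_itv /= => /andP[ax xb].
  rewrite [g0 * _]mulrC -mulrBr normrM ger0_norm// distrC.
  by rewrite [leRHS](_ : _ = p n x * (e / 2 / (m + 1) + C * h x)) ?ler_wpM2l ?HC//; ring.
rewrite RintegralD//; try exact: continuous_integrable; last first.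
  by apply: continuous_integrable => x; apply: cvgMl_tmp; exact: cph.
rewrite !RintegralZl//; try exact: continuous_integrable.
rewrite pm [leRHS]splitr lerD//.
  by rewrite mulrAC ler_pdivrMr ?ltr_wpDl// ler_wpM2l ?lerDl// divr_ge0// ltW.
apply: le_trans (ler_wpM2l C0 hn) _.
by rewrite mulrCA -[leRHS]mulr1 ler_wpM2l ?divr_ge0 ?(ltW e0)// ler_pdivrMr ?ltr_wpDl// mul1r lerDl.
Qed.

End Korovkin.

(** * Fourier coefficients of dn and cn *)

Section BoundedFamily.
Variables (R : realType) (d : R).
Implicit Types f g : R -> R -> R.

(** The domination required by [conservation]; the lemmas below propagate it through
    the arithmetic operations. *)
Definition bounded_where_sin_ge f :=
  exists M, forall phi psi, d <= sin psi -> `|f phi psi| <= M.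
Local Notation bdd := bounded_where_sin_ge.

Lemma bdd_le1 f : (forall phi psi, `|f phi psi| <= 1) -> bdd f.
Proof. by move=> f1; exists 1. Qed.

Lemma bdd_cst c : bdd (fun _ _ => c).
Proof. by exists `|c|. Qed.

Lemma bddN f : bdd f -> bdd (fun phi psi => - f phi psi).
Proof. by move=> [M fM]; exists M => phi psi ?; rewrite normrN fM. Qed.

Lemma bddD f g : bdd f -> bdd g -> bdd (fun phi psi => f phi psi + g phi psi).
Proof.
move=> [M fM] [N gN]; exists (M + N) => phi psi h.
by rewrite (le_trans (ler_normD _ _))// lerD ?fM ?gN.
Qed.

Lemma bddM f g : bdd f -> bdd g -> bdd (fun phi psi => f phi psi * g phi psi).
Proof.
move=> [M fM] [N gN]; exists (M * N) => phi psi h.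
by rewrite normrM ler_pM ?fM ?gN.
Qed.

Lemma bddX f n : bdd f -> bdd (fun phi psi => f phi psi ^+ n).
Proof.
by move=> [M fM]; exists (M ^+ n) => phi psi h; rewrite normrX lerXn2r ?nnegrE ?fM// (le_trans _ (fM phi psi h)).
Qed.

Lemma bddV f c : 0 < c -> (forall phi psi, d <= sin psi -> c <= f phi psi) ->
  bdd (fun phi psi => (f phi psi)^-1).
Proof.
move=> c0 fc; exists c^-1 => phi psi h; have f0 := lt_le_trans c0 (fc phi psi h).
by rewrite normfV gtr0_norm// lef_pV2 ?posrE ?fc.
Qed.

End BoundedFamily.

Section Kernels.
Variables (R : realType) (k : R).
Hypotheses (k_gt0 : 0 < k) (k_lt1 : k < 1).
Local Notation mu := (@lebesgue_measure R).
Local Notation F := (ellipticF k).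
Local Notation K := (ellipticK k).
Local Notation k' := (Num.sqrt (1 - k ^+ 2)).
Local Notation F' := (ellipticF k').
Local Notation K' := (ellipticK k').
Implicit Types phi psi lam : R.

Definition den phi psi := sin psi ^+ 2 + sin phi ^+ 2 * cos psi ^+ 2.

Lemma den_ge phi psi : sin psi ^+ 2 <= den phi psi.
Proof. by rewrite lerDl mulr_ge0 ?sqr_ge0. Qed.

Lemma den_ge_phi phi psi : sin phi ^+ 2 <= den phi psi.
Proof.
rewrite /den cos2sin2; have := sqr_ge0 (cos phi); rewrite cos2sin2.
have := sqr_ge0 (sin psi); move: (sin phi ^+2) (sin psi ^+ 2) => x y; nra.
Qed.

Lemma den_neq0 phi psi : 0 < sin psi -> den phi psi != 0.
Proof.
by move=> s0; rewrite gt_eqF// (lt_le_trans _ (den_ge phi psi))// exprn_gt0.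
Qed.

(** With x = F phi and y = K' - F' psi, these are the real and imaginary parts of
    dn (x + i y) and of k cn (x + i y), written in the amplitudes of x and of K' - y. *)
Definition Pdn phi psi := Delta k phi * sin psi / den phi psi.
Definition Qdn phi psi := - (sin phi * cos phi * cos psi * Delta k' psi / den phi psi).
Definition Pcn phi psi := cos phi * sin psi * Delta k' psi / den phi psi.
Definition Qcn phi psi := - (sin phi * Delta k phi * cos psi / den phi psi).

Let den1 phi psi := 2 * sin phi * cos phi * cos psi ^+ 2.
Let Delta1 phi := - k ^+ 2 * sin phi * cos phi / Delta k phi.

Definition Pdn1 phi psi := Delta1 phi * sin psi / den phi psi
  - Delta k phi * sin psi * den1 phi psi / den phi psi ^+ 2.
Definition Qdn1 phi psi := - ((cos phi ^+ 2 - sin phi ^+ 2) * cos psi * Delta k' psi / den phi psi)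
  + sin phi * cos phi * cos psi * Delta k' psi * den1 phi psi / den phi psi ^+ 2.
Definition Pcn1 phi psi := - (sin phi * sin psi * Delta k' psi / den phi psi)
  - cos phi * sin psi * Delta k' psi * den1 phi psi / den phi psi ^+ 2.
Definition Qcn1 phi psi := - ((cos phi * Delta k phi + sin phi * Delta1 phi) * cos psi / den phi psi)
  + sin phi * Delta k phi * cos psi * den1 phi psi / den phi psi ^+ 2.

Let k'_gt0 := compl_gt0 k_gt0 k_lt1.
Let k'_lt1 := compl_lt1 k_gt0.
Let dD := der_Delta k_gt0 k_lt1.
Let dD' := der_Delta k'_gt0 k'_lt1.
Let D0 := Delta_neq0 k_gt0 k_lt1.
Let D'0 := Delta_neq0 k'_gt0 k'_lt1.

Let k'_sqr : k' ^+ 2 = 1 - k ^+ 2.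
Proof. by rewrite sqr_sqrtr// subr_ge0 expr_le1// ltW. Qed.

Ltac kernel_partial1 :=
  let psi := fresh "psi" in let s0 := fresh "s0" in let phi := fresh "phi" in
  move=> psi s0 phi; have := den_neq0 phi s0; have := D0 phi; have := D'0 psi;
  have dk := dD;
  rewrite /Pdn /Qdn /Pcn /Qcn /Pdn1 /Qdn1 /Pcn1 /Qcn1 /den1 /Delta1 /den => ? ? ?;
  derive; [by [] | field; rewrite ?exprMn; repeat (apply/andP; split); by []].

Lemma der_Pdn1 psi : 0 < sin psi -> forall phi, is_derive phi (1 : R) (Pdn ^~ psi) (Pdn1 phi psi).
Proof. by move: psi; kernel_partial1. Qed.
Lemma der_Qdn1 psi : 0 < sin psi -> forall phi, is_derive phi (1 : R) (Qdn ^~ psi) (Qdn1 phi psi).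
Proof. by move: psi; kernel_partial1. Qed.
Lemma der_Pcn1 psi : 0 < sin psi -> forall phi, is_derive phi (1 : R) (Pcn ^~ psi) (Pcn1 phi psi).
Proof. by move: psi; kernel_partial1. Qed.
Lemma der_Qcn1 psi : 0 < sin psi -> forall phi, is_derive phi (1 : R) (Qcn ^~ psi) (Qcn1 phi psi).
Proof. by move: psi; kernel_partial1. Qed.

Ltac kernel_partial2 :=
  let psi := fresh "psi" in let s0 := fresh "s0" in let phi := fresh "phi" in
  move=> psi s0 phi; have := den_neq0 phi s0; have := D0 phi; have := D'0 psi;
  have dk := dD'; have := Delta_sqr k_gt0 k_lt1 phi; have := Delta_sqr k'_gt0 k'_lt1 psi;
  have := cos2sin2 phi; have := cos2sin2 psi; have := k'_sqr;
  rewrite /Pdn /Qdn /Pcn /Qcn /Pdn1 /Qdn1 /Pcn1 /Qcn1 /den1 /Delta1 /den =>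
    E1 E2 E3 E4 E5 ? ? ?;
  derive; [by [] | ].

Lemma der_Pdn2 psi : 0 < sin psi -> forall phi,
  is_derive psi (1 : R) (Pdn phi) (Delta k phi / Delta k' psi * Qdn1 phi psi).
Proof. by move: psi; kernel_partial2; field: E1 E2 E3 E4 E5; rewrite ?exprMn; repeat (apply/andP; split). Qed.
Lemma der_Qdn2 psi : 0 < sin psi -> forall phi,
  is_derive psi (1 : R) (Qdn phi) (- (Delta k phi / Delta k' psi * Pdn1 phi psi)).
Proof. by move: psi; kernel_partial2; field: E1 E2 E3 E4 E5; rewrite ?exprMn; repeat (apply/andP; split). Qed.
Lemma der_Pcn2 psi : 0 < sin psi -> forall phi,
  is_derive psi (1 : R) (Pcn phi) (Delta k phi / Delta k' psi * Qcn1 phi psi).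
Proof. by move: psi; kernel_partial2; field: E1 E2 E3 E4 E5; rewrite ?exprMn; repeat (apply/andP; split). Qed.
Lemma der_Qcn2 psi : 0 < sin psi -> forall phi,
  is_derive psi (1 : R) (Qcn phi) (- (Delta k phi / Delta k' psi * Pcn1 phi psi)).
Proof. by move: psi; kernel_partial2; field: E1 E2 E3 E4 E5; rewrite ?exprMn; repeat (apply/andP; split). Qed.

Ltac kernel_cont :=
  let psi := fresh "psi" in let s0 := fresh "s0" in
  move=> psi s0; have := den_neq0 ^~ psi; move/(_ _ s0); have := D0; have := D'0;
  have dk := dD;
  rewrite /Pdn1 /Qdn1 /Pcn1 /Qcn1 /den1 /Delta1 /den => ? ? ?;
  let t := fresh "t" in move=> t; eapply der_cont_at; der; rewrite ?expf_neq0.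

Lemma cont_Pdn1 psi : 0 < sin psi -> continuous (Pdn1 ^~ psi).
Proof. by move: psi; kernel_cont. Qed.
Lemma cont_Qdn1 psi : 0 < sin psi -> continuous (Qdn1 ^~ psi).
Proof. by move: psi; kernel_cont. Qed.
Lemma cont_Pcn1 psi : 0 < sin psi -> continuous (Pcn1 ^~ psi).
Proof. by move: psi; kernel_cont. Qed.
Lemma cont_Qcn1 psi : 0 < sin psi -> continuous (Qcn1 ^~ psi).
Proof. by move: psi; kernel_cont. Qed.

Let bdd_Delta d : bounded_where_sin_ge d (fun phi _ => Delta k phi).
Proof. by apply: bdd_le1 => phi _; rewrite ger0_norm ?Delta_le1// ltW// Delta_gt0. Qed.
Let bdd_Delta' d : bounded_where_sin_ge d (fun _ psi => Delta k' psi).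
Proof. by apply: bdd_le1 => _ psi; rewrite ger0_norm ?Delta_le1// ltW// Delta_gt0. Qed.
Let bdd_invDelta d : bounded_where_sin_ge d (fun phi _ => (Delta k phi)^-1).
Proof. by apply: (bddV k'_gt0) => phi psi _; exact: Delta_ge. Qed.
Let bdd_sin1 d : bounded_where_sin_ge d (fun phi _ => sin phi : R).
Proof. by apply: bdd_le1 => *; rewrite ler_norml sin_geN1 sin_le1. Qed.
Let bdd_sin2 d : bounded_where_sin_ge d (fun _ psi => sin psi : R).
Proof. by apply: bdd_le1 => *; rewrite ler_norml sin_geN1 sin_le1. Qed.
Let bdd_cos1 d : bounded_where_sin_ge d (fun phi _ => cos phi : R).
Proof. by apply: bdd_le1 => *; rewrite ler_norml cos_geN1 cos_le1. Qed.
Let bdd_cos2 d : bounded_where_sin_ge d (fun _ psi => cos psi : R).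
Proof. by apply: bdd_le1 => *; rewrite ler_norml cos_geN1 cos_le1. Qed.
Let bdd_invden d : 0 < d -> bounded_where_sin_ge d (fun phi psi => (den phi psi)^-1).
Proof.
move=> d0; have d20 : 0 < d ^+ 2 by rewrite exprn_gt0.
apply: (bddV d20) => phi psi h; rewrite (le_trans _ (den_ge phi psi))//.
by rewrite lerXn2r ?nnegrE// ltW// (lt_le_trans d0 h).
Qed.

Let bdd_invden2 d : 0 < d -> bounded_where_sin_ge d (fun phi psi => (den phi psi ^+ 2)^-1).
Proof.
move=> d0; have [M hM] := bddX 2 (bdd_invden d0).
by exists M => phi psi h; rewrite -exprVn; exact: hM.
Qed.

Ltac bdd d0 := rewrite /Pdn1 /Qdn1 /Pcn1 /Qcn1 /den1 /Delta1; repeat first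
  [ exact: bdd_Delta | exact: bdd_Delta' | exact: bdd_invDelta | exact: bdd_sin1
  | exact: bdd_sin2 | exact: bdd_cos1 | exact: bdd_cos2 | exact: (bdd_invden d0)
  | exact: (bdd_invden2 d0) | exact: bdd_cst
  | apply: bddD | apply: bddN | apply: bddM | apply: bddX ].

Lemma bdd_Pdn1 d : 0 < d -> bounded_where_sin_ge d Pdn1.
Proof. by move=> d0; bdd d0. Qed.
Lemma bdd_Qdn1 d : 0 < d -> bounded_where_sin_ge d Qdn1.
Proof. by move=> d0; bdd d0. Qed.
Lemma bdd_Pcn1 d : 0 < d -> bounded_where_sin_ge d Pcn1.
Proof. by move=> d0; bdd d0. Qed.
Lemma bdd_Qcn1 d : 0 < d -> bounded_where_sin_ge d Qcn1.
Proof. by move=> d0; bdd d0. Qed.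

(** [Pdn] divided by [Delta k phi], that is, the density of Re dn (x + i y) dx in phi. *)
Definition poisson psi phi := sin psi / den phi psi.

Lemma cont_poisson psi : 0 < sin psi -> continuous (poisson psi).
Proof.
move=> s0; have := den_neq0 ^~ psi; move/(_ _ s0); rewrite /poisson /den => H.
by move=> t; eapply der_cont_at; der.
Qed.

Local Notation J f := (Rintegral mu `[- (pi / 2), pi / 2]%classic f).

Let contF : continuous F := der_continuous (der_ellipticF k_gt0 k_lt1).

Let cont_cosF lam : continuous (fun phi => cos (lam * F phi)).
Proof.
have cl : continuous (fun phi => lam * F phi) by move=> x; apply: cvgMl_tmp; exact: contF.
by move=> x; exact: (continuous_comp (cl x) (@continuous_cos _ _)).
Qed.

Let cont_sinF lam : continuous (fun phi => sin (lam * F phi)).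
Proof.
have cl : continuous (fun phi => lam * F phi) by move=> x; apply: cvgMl_tmp; exact: contF.
by move=> x; exact: (continuous_comp (cl x) (@continuous_sin _ _)).
Qed.

Lemma den_pihalf phi : den phi (pi / 2) = 1.
Proof. by rewrite /den sin_pihalf cos_pihalf expr1n expr0n /= mulr0 addr0. Qed.

Lemma Delta_pihalf : Delta k' (pi / 2) = k.
Proof.
by rewrite /Delta sin_pihalf expr1n mulr1 k'_sqr opprB addrC subrK sqrtr_sqr gtr0_norm.
Qed.

(** The mean of the conservation laws for [lam] and [- lam], in which the odd term with
    [Q] cancels. *)
Let conservation_even (P Q P1 Q1 : R -> R -> R) lam psi c g :
  (forall psi, 0 < sin psi -> forall phi, is_derive phi (1 : R) (P ^~ psi) (P1 phi psi)) ->
  (forall psi, 0 < sin psi -> forall phi, is_derive phi (1 : R) (Q ^~ psi) (Q1 phi psi)) ->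
  (forall psi, 0 < sin psi -> forall phi,
    is_derive psi (1 : R) (P phi) (Delta k phi / Delta k' psi * Q1 phi psi)) ->
  (forall psi, 0 < sin psi -> forall phi,
    is_derive psi (1 : R) (Q phi) (- (Delta k phi / Delta k' psi * P1 phi psi))) ->
  (forall psi, 0 < sin psi -> continuous (P1 ^~ psi)) ->
  (forall psi, 0 < sin psi -> continuous (Q1 ^~ psi)) ->
  (forall d, 0 < d -> bounded_where_sin_ge d P1) ->
  (forall d, 0 < d -> bounded_where_sin_ge d Q1) ->
  (forall psi, Q (pi / 2) psi * cos (lam * K) = Q (- (pi / 2)) psi * cos (lam * K)) ->
  (forall psi, P (pi / 2) psi * sin (lam * K) = 0 /\ P (- (pi / 2)) psi * sin (lam * K) = 0) ->
  (forall phi, P phi (pi / 2) = c * (Delta k phi * g phi)) -> (forall phi, Q phi (pi / 2) = 0) ->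
  continuous g -> 0 < psi -> psi < pi ->
  J (fun phi => P phi psi / Delta k phi * cos (lam * F phi)) =
  (expR (lam * (F' psi - K')) + expR (- (lam * (F' psi - K')))) / 2 *
    (c * J (fun phi => g phi * cos (lam * F phi))).
Proof.
move=> dP1 dQ1 dP2 dQ2 cP1 cQ1 bP1 bQ1 hQ hP Pc Q0 cg psi0 psipi.
have s0 : 0 < sin psi by rewrite sin_gt0_pi// psi0 psipi.
have e1 : c * J (fun phi => g phi * cos (lam * F phi)) =
    J (fun phi => (P phi (pi / 2) * cos (lam * F phi) +
       Q phi (pi / 2) * sin (lam * F phi)) / Delta k phi).
  rewrite -RintegralZl//; last first.
    by apply: continuous_integrable => x; apply: cvgM; [exact: cg|exact: cont_cosF].
  by apply: eq_Rintegral => phi _; rewrite Pc Q0; field; exact: D0.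
have e2 : c * J (fun phi => g phi * cos (lam * F phi)) =
    J (fun phi => (P phi (pi / 2) * cos (- lam * F phi) +
       Q phi (pi / 2) * sin (- lam * F phi)) / Delta k phi).
  rewrite e1; apply: eq_Rintegral => phi _.
  by rewrite Q0 mulNr cosN !mul0r.
have cP : continuous (P ^~ psi) by exact: der_continuous (dP1 psi s0).
have cQ : continuous (Q ^~ psi) by exact: der_continuous (dQ1 psi s0).
have cI l : continuous (fun phi => (P phi psi * cos (l * F phi) +
    Q phi psi * sin (l * F phi)) / Delta k phi).
  move=> x; apply: cvgM; last exact: continuous_invDelta.
  apply: cvgD; apply: cvgM; [exact: cP|exact: cont_cosF|exact: cQ|exact: cont_sinF].
have half A B Y : (A + B) / 2 * Y = 2^-1 * (A * Y + B * Y) :> R by ring.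
have b1 y : Q (pi / 2) y * cos (lam * K) - P (pi / 2) y * sin (lam * K) =
    Q (- (pi / 2)) y * cos (lam * K) + P (- (pi / 2)) y * sin (lam * K).
  by rewrite hQ !(hP y).1 !(hP y).2 subr0 addr0.
have b2 y : Q (pi / 2) y * cos (- lam * K) - P (pi / 2) y * sin (- lam * K) =
    Q (- (pi / 2)) y * cos (- lam * K) + P (- (pi / 2)) y * sin (- lam * K).
  by rewrite mulNr cosN sinN !mulrN hQ !(hP y).1 !(hP y).2 oppr0 subr0 addr0.
rewrite half {1}e1 e2 -[- (lam * _)]mulNr.
rewrite -(conservation k_gt0 k_lt1 dP1 dQ1 dP2 dQ2 cP1 cQ1 bP1 bQ1 b1 psi0 psipi).
rewrite -(conservation k_gt0 k_lt1 dP1 dQ1 dP2 dQ2 cP1 cQ1 bP1 bQ1 b2 psi0 psipi).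
rewrite -RintegralD//; try exact: continuous_integrable.
rewrite -RintegralZl//; last first.
  by apply: continuous_integrable => x; apply: cvgD; exact: cI.
by apply: eq_Rintegral => phi _; rewrite mulNr cosN sinN; field; exact: D0.
Qed.

Lemma poisson_dn lam psi : sin (lam * K) = 0 -> 0 < psi -> psi < pi ->
  J (fun phi => poisson psi phi * cos (lam * F phi)) =
  (expR (lam * (F' psi - K')) + expR (- (lam * (F' psi - K')))) / 2 *
    J (fun phi => cos (lam * F phi)).
Proof.
move=> sK psi0 psipi.
have s0 : 0 < sin psi by rewrite sin_gt0_pi// psi0 psipi.
transitivity (J (fun phi => Pdn phi psi / Delta k phi * cos (lam * F phi))).
  by apply: eq_Rintegral => phi _; rewrite /Pdn /poisson; field; rewrite D0 den_neq0.
rewrite (conservation_even (c := 1) (g := fun=> 1) der_Pdn1 der_Qdn1 der_Pdn2 der_Qdn2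
  cont_Pdn1 cont_Qdn1 bdd_Pdn1 bdd_Qdn1)//.
- by rewrite mul1r; congr (_ * _); apply: eq_Rintegral => phi _; rewrite mul1r.
- by move=> y; rewrite /Qdn cosN cos_pihalf !(mulr0, mul0r, oppr0).
- by move=> y; rewrite sK !mulr0.
- by move=> phi; rewrite /Pdn den_pihalf sin_pihalf divr1 !mulr1 mul1r.
- by move=> phi; rewrite /Qdn cos_pihalf !(mulr0, mul0r, oppr0).
- exact: cst_continuous.
Qed.

Lemma poisson_cn lam psi : cos (lam * K) = 0 -> 0 < psi -> psi < pi ->
  Delta k' psi * J (fun phi => poisson psi phi * (cos phi * cos (lam * F phi) / Delta k phi)) =
  (expR (lam * (F' psi - K')) + expR (- (lam * (F' psi - K')))) / 2 *
    (k * J (fun phi => cos phi / Delta k phi * cos (lam * F phi))).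
Proof.
move=> cK psi0 psipi.
have s0 : 0 < sin psi by rewrite sin_gt0_pi// psi0 psipi.
have cgn : continuous (fun phi => cos phi / Delta k phi).
  by move=> x; apply: cvgM; [exact: continuous_cos|exact: continuous_invDelta].
rewrite -RintegralZl//; last first.
  apply: continuous_integrable => x; apply: cvgM; first exact: cont_poisson.
  apply: cvgM; last exact: continuous_invDelta.
  by apply: cvgM; [exact: continuous_cos|exact: cont_cosF].
transitivity (J (fun phi => Pcn phi psi / Delta k phi * cos (lam * F phi))).
  by apply: eq_Rintegral => phi _; rewrite /Pcn /poisson; ring.
rewrite (conservation_even (c := k) (g := fun phi => cos phi / Delta k phi)
  der_Pcn1 der_Qcn1 der_Pcn2 der_Qcn2 cont_Pcn1 cont_Qcn1 bdd_Pcn1 bdd_Qcn1)//.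
- by move=> y; rewrite cK !mulr0.
- by move=> y; rewrite /Pcn cosN cos_pihalf !mul0r.
- move=> phi; rewrite /Pcn den_pihalf sin_pihalf Delta_pihalf; field; exact: D0.
- by move=> phi; rewrite /Qcn cos_pihalf !(mulr0, mul0r, oppr0).
Qed.

Let J_cst c : J (fun=> c) = c * pi.
Proof.
have pi0 : - (pi / 2) < pi / 2 :> R by have := pi_gt0 R; lra.
have dc (x : R) : is_derive x (1 : R) (fun x => c * x) c by derive; ring.
have cc : continuous (fun _ : R => c) by exact: cst_continuous.
by rewrite (Rintegral_FTC2 pi0 cc dc); field.
Qed.

(** The case [lam = 0] of the conservation law: the integral is the one of the
    constant 1 at psi = pi / 2. *)
Lemma poisson_mass psi : 0 < psi -> psi < pi -> J (poisson psi) = pi.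
Proof.
move=> psi0 psipi; have := @poisson_dn 0 psi.
rewrite !mul0r sin0 oppr0 expR0 => /(_ erefl psi0 psipi).
have -> : J (fun phi => poisson psi phi * cos (0 * F phi)) = J (poisson psi).
  by apply: eq_Rintegral => phi _; rewrite mul0r cos0 mulr1.
have -> : J (fun phi => cos (0 * F phi)) = J (fun=> 1).
  by apply: eq_Rintegral => phi _; rewrite mul0r cos0.
move=> ->.
by rewrite J_cst; field.
Qed.

(** Values of psi tending to 0: the imaginary part y = K' - F' psi tends to that of the
    pole i K'. *)
Let approach n : R := n.+1%:R^-1.

Let approach_gt0 n : 0 < approach n. Proof. by rewrite invr_gt0. Qed.

Let approach_lt n : approach n < pi.
Proof. by rewrite (@le_lt_trans _ _ 1)// ?invf_le1 ?ler1n// (lt_le_trans _ (pi_ge2 _))// ltr1n. Qed.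

Let approach_sin n : 0 < sin (approach n).
Proof. by rewrite sin_gt0_pi// approach_gt0 approach_lt. Qed.

Let cvg_approach : approach @ \oo --> (0 : R).
Proof. exact: cvg_harmonic. Qed.

(** The kernel satisfies [poisson psi phi * sin phi ^+ 2 <= sin psi], so it
    concentrates at phi = 0. *)
Lemma poisson_cvg g : continuous g ->
  (fun n => J (fun phi => poisson (approach n) phi * g phi)) @ \oo --> pi * g 0.
Proof.
move=> cg.
have pi0 := pi_gt0 R.
have csin2 : continuous (fun phi : R => sin phi ^+ 2) by cont.
apply: (@korovkin _ _ _ g (fun phi => sin phi ^+ 2) (g 0) _ cg csin2).
- by lra.
- by move=> x; rewrite sqr_ge0.
- move=> x ax xb /eqP; rewrite sqrf_eq0 => /eqP sx.
  by rewrite (@sin_inj _ x 0) ?sin0 ?in_itv/= ?ax ?xb//; apply/andP; split; lra.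
- by move=> n; apply: cont_poisson.
- by move=> n x; rewrite divr_ge0 ?(ltW (approach_sin n))// (le_trans _ (den_ge x _))// sqr_ge0.
- by move=> n; apply: poisson_mass.
have cpn n : continuous (fun phi => poisson (approach n) phi * sin phi ^+ 2).
  by move=> x; apply: cvgM; [exact: cont_poisson|exact: csin2].
apply: (@squeeze_cvgr _ _ _ _ (cst 0) (fun n => sin (approach n) * pi)).
- apply: nearW => n; apply/andP; split.
    apply: Rintegral_ge0 => x _; rewrite mulr_ge0 ?sqr_ge0//.
    by rewrite divr_ge0 ?(ltW (approach_sin n))// (le_trans _ (den_ge x _))// sqr_ge0.
  have -> : sin (approach n) * pi = J (fun=> sin (approach n)).
    by rewrite J_cst.
  apply: le_Rintegral => //; try exact: continuous_integrable.
    by apply: continuous_integrable; exact: cst_continuous.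
  move=> x _; rewrite /poisson mulrAC ler_pdivrMr.
    by rewrite ler_wpM2l ?den_ge_phi// ltW.
  by rewrite (lt_le_trans _ (den_ge x _))// exprn_gt0.
- exact: cvg_cst.
- rewrite -(mul0r pi) -(sin0 R); apply: cvgMr_tmp.
  exact: (continuous_cvg _ (@continuous_sin R 0) cvg_approach).
Qed.

Let weight lam n := (expR (lam * (F' (approach n) - K')) + expR (- (lam * (F' (approach n) - K')))) / 2.

Let cvg_weight lam :
  weight lam @ \oo --> (expR (lam * K') + expR (- (lam * K'))) / 2.
Proof.
have cF' := der_continuous (der_ellipticF k'_gt0 k'_lt1).
have c : (fun n => lam * (F' (approach n) - K')) @ \oo --> - (lam * K').
  have -> : - (lam * K') = lam * (F' 0 - K') by rewrite ellipticF0; ring.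
  apply: cvgMl_tmp; apply: cvgB; last exact: cvg_cst.
  exact: (continuous_cvg _ (cF' 0) cvg_approach).
have c1 := continuous_cvg _ (@continuous_expR R _) c.
have c2 := continuous_cvg _ (@continuous_expR R _) (cvgN c).
rewrite opprK in c2; rewrite [expR (lam * K') + _]addrC.
by apply: cvgMr_tmp; apply: cvgD; [exact: c1|exact: c2].
Qed.

(** The two expressions of the limit of the integrals in [poisson_dn] as psi tends to 0. *)
Lemma fourier_dn lam : sin (lam * K) = 0 ->
  J (fun phi => cos (lam * F phi)) = 2 * pi / (expR (lam * K') + expR (- (lam * K'))).
Proof.
move=> sK.
have := poisson_cvg (@cont_cosF lam).
have -> : (fun n => J (fun phi => poisson (approach n) phi * cos (lam * F phi))) =
    (fun n => weight lam n * J (fun phi => cos (lam * F phi))).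
  by apply/funext => n; rewrite poisson_dn.
rewrite ellipticF0 mulr0 cos0 mulr1 => h1.
have h2 : (fun n => weight lam n * J (fun phi => cos (lam * F phi))) @ \oo -->
  (expR (lam * K') + expR (- (lam * K'))) / 2 * J (fun phi => cos (lam * F phi)).
  exact: cvgMr_tmp (@cvg_weight lam).
have := etrans (esym (cvg_lim (@Rhausdorff R) h1)) (cvg_lim (@Rhausdorff R) h2).
have E0 : expR (lam * K') + expR (- (lam * K')) != 0 by rewrite gt_eqF// addr_gt0 ?expR_gt0.
by move=> e; apply: (mulIf E0); rewrite divfK// [in RHS]e; field.
Qed.

Lemma fourier_cn lam : cos (lam * K) = 0 ->
  J (fun phi => cos phi / Delta k phi * cos (lam * F phi)) =
  2 * pi / (k * (expR (lam * K') + expR (- (lam * K')))).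
Proof.
move=> cK.
have cg : continuous (fun phi => cos phi * cos (lam * F phi) / Delta k phi).
  move=> x; apply: cvgM; last exact: continuous_invDelta.
  by apply: cvgM; [exact: continuous_cos|exact: cont_cosF].
have := poisson_cvg cg.
rewrite ellipticF0 mulr0 cos0 /Delta sin0 expr0n mulr0 subr0 sqrtr1 divr1 !mulr1 -/(Delta k) => h0.
have cD : (fun n => Delta k' (approach n)) @ \oo --> Delta k' 0.
  have cD' : continuous (Delta k') := der_continuous dD'.
  exact: (continuous_cvg _ (cD' 0) cvg_approach).
have D10 : Delta k' 0 = 1 by rewrite /Delta sin0 expr0n mulr0 subr0 sqrtr1.
rewrite D10 in cD.
have h1 := cvgM cD h0; rewrite mul1r in h1.
set I := J (fun phi => cos phi / Delta k phi * cos (lam * F phi)).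
have h2 : (fun n => weight lam n * (k * I)) @ \oo -->
  (expR (lam * K') + expR (- (lam * K'))) / 2 * (k * I).
  exact: cvgMr_tmp (@cvg_weight lam).
have e : (fun n => Delta k' (approach n) * J (fun phi => poisson (approach n) phi *
      (cos phi * cos (lam * F phi) / Delta k phi))) =
    (fun n => weight lam n * (k * I)).
  by apply/funext => n; rewrite poisson_cn.
have h3 : (fun n => Delta k' (approach n) * J (fun phi => poisson (approach n) phi *
      (cos phi * cos (lam * F phi) / Delta k phi))) @ \oo --> (pi : R) by exact: h1.
rewrite e in h3.
have := etrans (esym (cvg_lim (@Rhausdorff R) h3)) (cvg_lim (@Rhausdorff R) h2).
have E0 : k * (expR (lam * K') + expR (- (lam * K'))) != 0.
  by rewrite mulf_neq0 ?(gt_eqF k_gt0)// gt_eqF// addr_gt0 ?expR_gt0.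
by move=> epi; apply: (mulIf E0); rewrite divfK// [in RHS]epi; field.
Qed.

End Kernels.

(** * Fejer inversion *)

Section Fejer.
Variable R : realType.
Implicit Types (t o : R) (n N : nat).

Definition dirichlet n t : R := 1 + \sum_(i < n) 2 * cos (i.+1%:R * t).
Definition fejer N t : R := \sum_(n < N) dirichlet n t.

Lemma dirichlet_mul n t : dirichlet n t * (1 - cos t) = cos (n%:R * t) - cos (n.+1%:R * t).
Proof.
elim: n => [|n IH]; first by rewrite /dirichlet big_ord0 mul0r cos0 mul1r addr0 mul1r.
rewrite /dirichlet big_ord_recr /= addrA -/(dirichlet n t) mulrDl IH.
have -> : n.+2%:R * t = n.+1%:R * t + t by rewrite -[n.+2%:R]natr1; ring.
have -> : n%:R * t = n.+1%:R * t - t by rewrite -natr1; ring.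
rewrite cosB cosD; ring.
Qed.

Lemma fejer_mul N t : fejer N t * (1 - cos t) = 1 - cos (N%:R * t).
Proof.
elim: N => [|N IH]; first by rewrite /fejer big_ord0 !mul0r cos0 subrr.
by rewrite /fejer big_ord_recr /= -/(fejer N t) mulrDl IH dirichlet_mul; ring.
Qed.

(** The squared modulus of the sum of exp (i n t) over [n < N]. *)
Lemma fejer_sqr N t :
  fejer N t = (\sum_(n < N) cos (n%:R * t)) ^+ 2 + (\sum_(n < N) sin (n%:R * t)) ^+ 2.
Proof.
elim: N => [|N IH]; first by rewrite /fejer !big_ord0 expr0n addr0.
rewrite /fejer !big_ord_recr /= -/(fejer N t) IH.
have -> : dirichlet N t = 1 + 2 * ((\sum_(n < N) cos (n%:R * t)) * cos (N%:R * t) +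
    (\sum_(n < N) sin (n%:R * t)) * sin (N%:R * t)).
  rewrite /dirichlet !mulr_suml -big_split mulr_sumr; congr (_ + _).
  rewrite [RHS](reindex_inj rev_ord_inj); apply: eq_bigr => i _ /=; congr (_ * _).
  rewrite -cosB -[in LHS]cosN; congr cos.
  by rewrite natrB//; ring.
have := cos2sin2 (N%:R * t).
move: (\sum_(n < N) cos _) (\sum_(n < N) sin _) (cos _) (sin _) => A B c s e.
ring: e.
Qed.

Lemma fejer_ge0 N t : 0 <= fejer N t.
Proof. by rewrite fejer_sqr addr_ge0 ?sqr_ge0. Qed.

(** The factor cos (o t) shifts all frequencies by [o]; with o = - 1/2 Fejer's kernel
    sums series in half-integral frequencies as well. *)
Lemma dirichlet_shift n o t : dirichlet n t * cos (o * t) = cos (o * t) +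
  \sum_(i < n) (cos ((i.+1%:R + o) * t) + cos ((- i.+1%:R + o) * t)).
Proof.
rewrite /dirichlet mulrDl mul1r mulr_suml; congr (_ + _).
apply: eq_bigr => i _.
have -> : (i.+1%:R + o) * t = o * t + i.+1%:R * t by ring.
have -> : (- i.+1%:R + o) * t = o * t - i.+1%:R * t by ring.
rewrite cosB cosD; ring.
Qed.

Lemma continuous_dirichlet n : continuous (dirichlet n).
Proof.
move=> t; apply: cvgD; first exact: cvg_cst.
suff c : continuous (fun t => \sum_(i < n) 2 * cos (i.+1%:R * t)) by exact: c.
apply: continuous_big; first exact: add_continuous.
by move=> i _; cont.
Qed.

Lemma continuous_fejer N : continuous (fejer N).
Proof.
apply: continuous_big; first exact: add_continuous.
by move=> i _; exact: continuous_dirichlet.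
Qed.

Lemma sinDnpi (x : R) n : sin (x + n%:R * pi) = (-1) ^+ n * sin x.
Proof.
elim: n => [|n IH]; first by rewrite mul0r addr0 mul1r.
by rewrite -natr1 mulrDl mul1r addrA sinDpi IH exprS mulN1r mulNr.
Qed.

Lemma cos_eq1 t : - (2 * pi) < t -> t < 2 * pi -> cos t = 1 -> t = 0.
Proof.
move=> t1 t2 c1; have s0 : sin (t / 2) = 0.
  have := c1; rewrite [t in cos t]splitr cosD -!expr2 cos2sin2 => e.
  by apply/eqP; rewrite -sqrf_eq0; apply/eqP; lra.
case: (ltgtP t 0) => // h.
  have : 0 < sin (- (t / 2)) by apply: sin_gt0_pi; apply/andP; split; lra.
  by rewrite sinN s0 oppr0 ltxx.
have : 0 < sin (t / 2) by apply: sin_gt0_pi; apply/andP; split; lra.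
by rewrite s0 ltxx.
Qed.

End Fejer.

Lemma bilateral_sum_symmetric (R : realType) (c : int -> R) l : bilateral_sum c l ->
  (fun n => c 0 + \sum_(i < n) (c i.+1%:Z + c (- i.+1%:Z))) @ \oo --> l.
Proof.
move=> [l1 [l2 [h1 h2 ->]]].
have h1' : (fun n => series (fun s : nat => c s%:Z) n.+1) @ \oo --> l1 by rewrite cvg_shiftS.
suff -> : (fun n => c 0 + \sum_(i < n) (c i.+1%:Z + c (- i.+1%:Z))) =
  (fun n => series (fun s : nat => c s%:Z) n.+1 + series (fun s : nat => c (- (s.+1)%:Z)) n).
  exact: cvgD.
apply/funext => n; rewrite /series /= !big_mkord big_ord_recl big_split /= addrA.
by congr (_ + _ + _); apply: eq_bigr.
Qed.

Section FourierInversion.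
Variables (R : realType) (k : R).
Hypotheses (k_gt0 : 0 < k) (k_lt1 : k < 1).
Local Notation mu := (@lebesgue_measure R).
Local Notation F := (ellipticF k).
Local Notation K := (ellipticK k).
Local Notation J f := (Rintegral mu `[- (pi / 2), pi / 2]%classic f).

Lemma ellipticK_gt0 : 0 < K.
Proof.
have pi0 := pi_gt0 R; have : 0 <= pi / 2 :> R by lra.
move/(ellipticF_ler k_gt0 k_lt1); rewrite ellipticF0 ellipticF_pihalf; lra.
Qed.

Variables (f : R -> R) (o phi0 : R).
Hypotheses (cf : continuous f) (fN : forall x, f (- x) = f x).
Hypotheses (phi0_gt : - (pi / 2) < phi0) (phi0_lt : phi0 < pi / 2).

Let om := pi / K.
Let t phi := om * (F phi - F phi0).

Let ct : continuous t.
Proof.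
have dF := der_ellipticF k_gt0 k_lt1; rewrite /t; cont.
Qed.

Let J_cost n : J (fun phi => cos (n.+1%:R * t phi) / Delta k phi) = 0.
Proof.
have K0 := ellipticK_gt0; have pi0 := pi_gt0 R.
have pp : - (pi / 2) < pi / 2 :> R by lra.
have dF := der_ellipticF k_gt0 k_lt1.
have n0 : n.+1%:R != 0 :> R by rewrite pnatr_eq0.
have d phi : is_derive phi (1 : R) (fun phi => (n.+1%:R * om)^-1 * sin (n.+1%:R * t phi))
    (cos (n.+1%:R * t phi) / Delta k phi).
  have om0 : om != 0 by rewrite /om mulf_neq0 ?invr_neq0// gt_eqF.
  rewrite /t; derive; move: om om0 (n.+1%:R) n0 => u u0 a a0; field.
  by rewrite (Delta_neq0 k_gt0 k_lt1) a0 u0.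
have cc : continuous (fun phi => cos (n.+1%:R * t phi) / Delta k phi).
  have dD := der_Delta k_gt0 k_lt1.
  by rewrite /t; cont; exact: Delta_neq0.
rewrite (Rintegral_FTC2 pp cc d) -mulrBr.
have -> : n.+1%:R * t (pi / 2) = n.+1%:R * t (- (pi / 2)) + (2 * n.+1)%:R * pi.
  by rewrite natrM /t (ellipticFN k_gt0 k_lt1) ellipticF_pihalf /om; field; rewrite gt_eqF.
by rewrite sinDnpi exprM sqrrN expr1n expr1n mul1r subrr mulr0.
Qed.

Let cinv : continuous (fun phi => (Delta k phi)^-1) := continuous_invDelta k_gt0 k_lt1.

Let J_inv : J (fun phi => (Delta k phi)^-1) = 2 * K.
Proof.
have pp : - (pi / 2) < pi / 2 :> R by have := pi_gt0 R; lra.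
rewrite (Rintegral_FTC2 pp cinv (der_ellipticF k_gt0 k_lt1)).
rewrite (ellipticFN k_gt0 k_lt1) ellipticF_pihalf; ring.
Qed.

Let ccost n : continuous (fun phi => cos (n.+1%:R * t phi) / Delta k phi).
Proof.
have dD := der_Delta k_gt0 k_lt1; have dF := der_ellipticF k_gt0 k_lt1.
by rewrite /t; cont; exact: Delta_neq0.
Qed.

Let J_dirichlet n : J (fun phi => dirichlet n (t phi) / Delta k phi) = 2 * K.
Proof.
have cs i : continuous (fun phi => 2 * (cos (i.+1%:R * t phi) / Delta k phi)).
  by move=> x; apply: cvgMl_tmp; exact: ccost.
transitivity (J (fun phi => (Delta k phi)^-1 +
    \sum_(i < n) 2 * (cos (i.+1%:R * t phi) / Delta k phi))).
  apply: eq_Rintegral => phi _; rewrite /dirichlet mulrDl mul1r mulr_suml.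
  by congr (_ + _); apply: eq_bigr => i _; rewrite mulrA.
rewrite RintegralD//; first last.
- apply: continuous_integrable; apply: continuous_big; first exact: add_continuous.
  by move=> i _; exact: cs.
- exact: continuous_integrable.
rewrite J_inv (@Rintegral_sum _ n (fun i phi => 2 * (cos (i.+1%:R * t phi) / Delta k phi)))//.
rewrite big1 ?addr0// => i _; rewrite RintegralZl//; last exact: continuous_integrable.
by rewrite J_cost mulr0.
Qed.

Let p N phi := N.+1%:R^-1 * (fejer N.+1 (t phi) / Delta k phi).

Let cp N : continuous (p N).
Proof.
move=> x; apply: cvgMl_tmp; apply: cvgM; last exact: cinv.
exact: (continuous_comp (@ct x) (@continuous_fejer _ N.+1 (t x))).
Qed.

Let J_average N (G : nat -> R -> R) : (forall n, continuous (G n)) ->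
  J (fun phi => N.+1%:R^-1 * \sum_(n < N.+1) G n phi) =
  arithmetic_mean (fun n => J (G n)) N.
Proof.
move=> cG; rewrite RintegralZl//; last first.
  apply: continuous_integrable; apply: continuous_big; first exact: add_continuous.
  by move=> i _; exact: cG.
by rewrite Rintegral_sum// /arithmetic_mean /series /= big_mkord.
Qed.

Let cdir n : continuous (fun phi => dirichlet n (t phi)).
Proof. by move=> x; exact: (continuous_comp (@ct x) (@continuous_dirichlet _ n (t x))). Qed.

Let J_p N : J (p N) = 2 * K.
Proof.
transitivity (J (fun phi => N.+1%:R^-1 * \sum_(n < N.+1) (dirichlet n (t phi) / Delta k phi))).
  by apply: eq_Rintegral => phi _; rewrite /p /fejer mulr_suml.
rewrite (J_average N (G := fun n phi => dirichlet n (t phi) / Delta k phi)); last first.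
  by move=> n x; apply: cvgM; [exact: cdir|exact: cinv].
rewrite /arithmetic_mean /series /=; under eq_bigr do rewrite J_dirichlet.
by rewrite sumr_const_nat subn0 -[(2 * K) *+ _]mulr_natl mulKf// pnatr_eq0.
Qed.

Let J_odd (g : R -> R) : continuous g -> (forall x, g (- x) = - g x) -> J g = 0.
Proof.
move=> cg gN.
have h : J g = J (fun x => - g x).
  rewrite /Rintegral; congr fine.
  have pp : - (pi / 2) <= pi / 2 :> R by have := pi_gt0 R; lra.
  have := integration_by_substitution_oppr pp (G := g).
  rewrite opprK => ->; last exact: continuous_subspaceT.
  by apply: eq_integral => x _; rewrite /= gN.
have : J (fun x => -1 * g x) = -1 * J g by rewrite RintegralZl//; exact: continuous_integrable.
rewrite mulN1r => e; have : J g = - J g.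
  by rewrite {1}h -e; apply: eq_Rintegral => x _; rewrite mulN1r.
by move/eqP; rewrite -addr_eq0 -mulr2n mulrn_eq0 /= => /eqP.
Qed.

Definition fourier_coef nu := J (fun phi => f phi / Delta k phi * cos (nu * om * F phi)).

Let J_cos nu : J (fun phi => f phi * cos (nu * t phi) / Delta k phi) =
  fourier_coef nu * cos (nu * om * F phi0).
Proof.
have cF : continuous F := der_continuous (der_ellipticF k_gt0 k_lt1).
have cnF : continuous (fun phi => nu * om * F phi) by move=> x; apply: cvgMl_tmp; exact: cF.
have cfD : continuous (fun phi => f phi / Delta k phi).
  by move=> x; apply: cvgM; [exact: cf|exact: cinv].
have c1 : continuous (fun phi => f phi / Delta k phi * cos (nu * om * F phi)).
  move=> x; apply: cvgM; first exact: cfD.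
  exact: (continuous_comp (cnF x) (@continuous_cos _ _)).
have c2 : continuous (fun phi => f phi / Delta k phi * sin (nu * om * F phi)).
  move=> x; apply: cvgM; first exact: cfD.
  exact: (continuous_comp (cnF x) (@continuous_sin _ _)).
transitivity (J (fun phi =>
    cos (nu * om * F phi0) * (f phi / Delta k phi * cos (nu * om * F phi)) +
    sin (nu * om * F phi0) * (f phi / Delta k phi * sin (nu * om * F phi)))).
  apply: eq_Rintegral => phi _.
  have -> : nu * t phi = nu * om * F phi - nu * om * F phi0 by rewrite /t; ring.
  rewrite cosB; ring.
rewrite RintegralD//; [|apply: continuous_integrable..]; first last.
- by move=> x; apply: cvgMl_tmp; exact: c2.
- by move=> x; apply: cvgMl_tmp; exact: c1.
rewrite !RintegralZl//; try exact: continuous_integrable.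
rewrite (J_odd c2) ?mulr0 ?addr0; first by rewrite mulrC.
by move=> x; rewrite fN (ellipticFN k_gt0 k_lt1) mulrN sinN mulrN /Delta sinN sqrrN.
Qed.

Let c (s : int) := fourier_coef (s%:~R + o) * cos ((s%:~R + o) * om * F phi0).

Let J_partial n : J (fun phi => dirichlet n (t phi) * (f phi * cos (o * t phi)) / Delta k phi) =
  c 0 + \sum_(i < n) (c i.+1%:Z + c (- i.+1%:Z)).
Proof.
have cfc nu : continuous (fun phi => f phi * cos (nu * t phi) / Delta k phi).
  have cnt : continuous (fun phi => nu * t phi) by move=> x; apply: cvgMl_tmp; exact: ct.
  move=> x; apply: cvgM; last exact: cinv.
  apply: cvgM; first exact: cf.
  exact: (continuous_comp (cnt x) (@continuous_cos _ _)).
have cfc2 i : continuous (fun phi => f phi * cos ((i.+1%:R + o) * t phi) / Delta k phi +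
    f phi * cos ((- i.+1%:R + o) * t phi) / Delta k phi).
  by move=> x; apply: cvgD; exact: cfc.
transitivity (J (fun phi => f phi * cos (o * t phi) / Delta k phi +
    \sum_(i < n) (f phi * cos ((i.+1%:R + o) * t phi) / Delta k phi +
      f phi * cos ((- i.+1%:R + o) * t phi) / Delta k phi))).
  apply: eq_Rintegral => phi _.
  rewrite mulrCA mulrAC dirichlet_shift mulrC [f phi / _]mulrC mulrDl.
  congr (_ + _); first by ring.
  by rewrite mulr_suml; apply: eq_bigr => i _; ring.
rewrite RintegralD//; first last.
- apply: continuous_integrable; apply: continuous_big; first exact: add_continuous.
  by move=> i _; exact: cfc2.
- exact: continuous_integrable.
rewrite J_cos (Rintegral_sum _ _ _ cfc2) /c add0r; congr (_ + _).
apply: eq_bigr => i _; rewrite RintegralD//; try exact: continuous_integrable.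
by rewrite !J_cos.
Qed.

(** Fejer's kernel in the variable t, with test function f cos (o t), concentrates at
    phi0: the end points of the interval are excluded, so t stays strictly between
    - 2 pi and 2 pi and [1 - cos t] vanishes at [phi0] only.  The Cesaro means of the
    partial sums have the same limit as the series itself. *)
Lemma fourier_inversion l : bilateral_sum c l -> l = 2 * K * f phi0.
Proof.
move=> cl.
have K0 := ellipticK_gt0; have pi0 := pi_gt0 R.
have om0 : 0 < om by rewrite divr_gt0.
have cg : continuous (fun phi => f phi * cos (o * t phi)).
  have cnt : continuous (fun phi => o * t phi) by move=> x; apply: cvgMl_tmp; exact: ct.
  move=> x; apply: cvgM; first exact: cf.
  exact: (continuous_comp (cnt x) (@continuous_cos _ _)).
have ch : continuous (fun phi => 1 - cos (t phi)).
  move=> x; apply: cvgB; first exact: cvg_cst.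
  exact: (continuous_comp (@ct x) (@continuous_cos _ _)).
have h_ge0 x : 0 <= 1 - cos (t x) by rewrite subr_ge0 cos_le1.
have hp : (fun N => J (fun phi => p N phi * (f phi * cos (o * t phi)))) @ \oo --> 2 * K * f phi0.
  apply: (@korovkin _ _ _ _ (fun phi => 1 - cos (t phi)) (f phi0) _ cg ch h_ge0) => //.
  - lra.
  - move=> x ax xb /eqP; rewrite subr_eq0 eq_sym => /eqP /cos_eq1 tx.
    have omK : om * K = pi by rewrite /om divfK// gt_eqF.
    have Fx1 : F x <= K.
      by have := ellipticF_ler k_gt0 k_lt1 xb; rewrite ellipticF_pihalf; lra.
    have Fx2 : - K <= F x.
      have := ellipticF_ler k_gt0 k_lt1 ax.
      by rewrite (ellipticFN k_gt0 k_lt1) ellipticF_pihalf; lra.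
    have F01 : F phi0 < K by rewrite -ellipticF_pihalf; exact: ellipticF_lt.
    have F02 : - K < F phi0.
      by rewrite -ellipticF_pihalf -(ellipticFN k_gt0 k_lt1); exact: ellipticF_lt.
    have {}tx : t x = 0.
      have e2 : 2 * pi = om * (2 * K) by rewrite mulrCA omK.
      apply: tx; rewrite e2 /t -?mulrN ltr_pM2l//; lra.
    rewrite tx mulr0 cos0 mulr1; congr f; apply: (ellipticF_inj k_gt0 k_lt1).
    move/eqP: tx; rewrite /t mulf_eq0 gt_eqF//= subr_eq0 => /eqP //.
  - by move=> N x; rewrite !mulr_ge0 ?invr_ge0 ?fejer_ge0// ltW// Delta_gt0.
  have pE N phi : p N phi * (1 - cos (t phi)) =
      N.+1%:R^-1 * ((1 - cos (N.+1%:R * t phi)) / Delta k phi).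
    by rewrite -fejer_mul /p; ring.
  apply: (@squeeze_cvgr _ _ _ _ (cst 0) (fun N => N.+1%:R^-1 * (2 * (2 * K)))).
  - apply: nearW => N; apply/andP; split.
      apply: Rintegral_ge0 => x _; rewrite pE !mulr_ge0 ?invr_ge0 ?subr_ge0 ?cos_le1//.
      by rewrite ltW// Delta_gt0.
    rewrite -J_inv -RintegralZl//; last exact: continuous_integrable.
    have c2 : continuous (fun phi => 2 / Delta k phi).
      by move=> x; apply: cvgMl_tmp; exact: cinv.
    rewrite -RintegralZl//; last exact: continuous_integrable.
    apply: le_Rintegral => //; try apply: continuous_integrable.
    + by move=> x; apply: cvgM; [exact: cp|exact: ch].
    + by move=> x; apply: cvgMl_tmp; exact: c2.
    move=> x _; rewrite pE ler_wpM2l ?invr_ge0// ler_wpM2r//.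
      by rewrite invr_ge0 ltW// Delta_gt0.
    by have := cos_geN1 (N.+1%:R * t x); lra.
  - exact: cvg_cst.
  - rewrite -(mul0r (2 * (2 * K))); apply: cvgMr_tmp; exact: cvg_harmonic.
have hm := cesaro (bilateral_sum_symmetric cl).
have e : arithmetic_mean (fun n => c 0 + \sum_(i < n) (c i.+1%:Z + c (- i.+1%:Z))) =
    (fun N => J (fun phi => p N phi * (f phi * cos (o * t phi)))).
  apply/funext => N.
  have -> : (fun n => c 0 + \sum_(i < n) (c i.+1%:Z + c (- i.+1%:Z))) =
    (fun n => J (fun phi => dirichlet n (t phi) * (f phi * cos (o * t phi)) / Delta k phi)).
    by apply/funext => n; rewrite J_partial.
  rewrite -J_average; last first.
    by move=> n x; apply: cvgM; [apply: cvgM; [exact: cdir|exact: cg]|exact: cinv].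
  by apply: eq_Rintegral => phi _; rewrite /p /fejer -mulr_suml -mulr_suml; ring.
rewrite e in hm.
by rewrite -(cvg_lim (@Rhausdorff R) hm) (cvg_lim (@Rhausdorff R) hp).
Qed.

End FourierInversion.

(** * Irrational rotations *)

Section IrrationalRotation.
Variable R : realType.
Implicit Types (x t e gamma : R).

Lemma irrational_intr gamma (j m : int) : irrational gamma -> j != 0 ->
  j%:~R * gamma <> m%:~R.
Proof.
move=> irr j0 e; apply: irr; exists (m%:~R / j%:~R) => //.
by rewrite fmorph_div /= !ratr_int -e mulrC mulKf// intr_eq0.
Qed.

(** Pigeonhole: among N + 1 multiples of [gamma], two have fractional parts in the
    same interval of length 1 / N. *)
Lemma small_intr_combination gamma e : irrational gamma -> 0 < e ->
  exists s m : int, (s%:~R * gamma - m%:~R != 0) /\ `|s%:~R * gamma - m%:~R| < e.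
Proof.
move=> irr e0.
pose N := (Num.truncn e^-1).+1.
have N0 : 0 < N%:R :> R by rewrite ltr0n.
have Ne : N%:R^-1 < e.
  by rewrite -[ltRHS]invrK ltf_pV2 ?posrE ?invr_gt0// truncnS_gt.
pose fr i : R := i%:R * gamma - (Num.floor (i%:R * gamma))%:~R.
have fr0 i : 0 <= fr i by rewrite subr_ge0 floor_le.
have fr1 i : fr i < 1.
  by rewrite ltrBlDl; have := floorD1_gt (i%:R * gamma); rewrite rmorphD.
have trN i : (Num.truncn (N%:R * fr i) < N)%N.
  by rewrite truncn_lt_nat ?mulr_ge0 ?(ltW N0)// -[ltRHS]mulr1 ltr_pM2l.
pose bin (i : 'I_N.+1) : 'I_N := Ordinal (trN i).
have /injectivePn [i [j ij bij]] : ~~ injectiveb bin.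
  by apply/injectiveP => /leq_card; rewrite !card_ord ltnn.
exists (j%:Z - i%:Z), (Num.floor (j%:R * gamma) - Num.floor (i%:R * gamma)).
have -> : (j%:Z - i%:Z)%:~R * gamma -
    (Num.floor (j%:R * gamma) - Num.floor (i%:R * gamma))%:~R = fr j - fr i.
  by rewrite !rmorphB /= -!pmulrn /fr; ring.
split.
  rewrite subr_eq0; apply/eqP => frE.
  have ji : j%:Z - i%:Z != 0 by rewrite subr_eq0; apply: contra ij => /eqP [] /val_inj ->.
  apply: (@irrational_intr gamma _ (Num.floor (j%:R * gamma) - Num.floor (i%:R * gamma)) irr ji).
  move: frE; rewrite /fr !rmorphB /= -!pmulrn mulrBl; lra.
apply: lt_trans Ne; rewrite -(ltr_pM2l N0) divff ?gt_eqF//.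
rewrite -[X in X * _](gtr0_norm N0) -normrM mulrBr ltr_norml.
have {bij} /(congr1 val) /= bE := bij.
have /andP[ai bi] := truncn_itv (mulr_ge0 (ltW N0) (fr0 i)).
have /andP[aj bj] := truncn_itv (mulr_ge0 (ltW N0) (fr0 j)).
rewrite bE in ai bi; rewrite -natr1 in bi bj.
by apply/andP; split; lra.
Qed.

(** Multiples of a small nonzero number come close to every [t]. *)
Lemma kronecker gamma t e : irrational gamma -> 0 < e ->
  exists s m : int, `|s%:~R * gamma - m%:~R - t| < e.
Proof.
move=> irr e0; have [s [m [d0 de]]] := small_intr_combination irr e0.
set d := s%:~R * gamma - m%:~R in d0 de.
pose n := Num.floor (t / d).
exists (n * s), (n * m).
have -> : (n * s)%:~R * gamma - (n * m)%:~R - t = (n%:~R - t / d) * d.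
  by rewrite mulrBl divfK// /d !rmorphM /=; ring.
rewrite normrM; apply: le_lt_trans de; rewrite ler_piMl//.
have := floor_le (t / d); have := floorD1_gt (t / d); rewrite rmorphD /= -/n => h1 h2.
by rewrite ler_norml; apply/andP; split; lra.
Qed.

Lemma cosD2zpi x (m : int) : cos (x + m%:~R * (2 * pi)) = cos x.
Proof.
have nat_case (n : nat) (y : R) : cos (y + n%:R * (2 * pi)) = cos y.
  by rewrite mulrA -natrM cosDnpi mulnC exprM sqrrN !expr1n mul1r.
case: m => n; first exact: nat_case.
by rewrite NegzE mulrNz mulNr -[LHS](nat_case n.+1) subrK.
Qed.

Lemma dense_cos_orbit (al be : R) : irrational (al / (2 * pi)) ->
  closure (range (fun s : int => cos (al * s%:~R + be))) = `[-1, 1]%classic.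
Proof.
move=> irr; have pi0 := pi_gt0 R.
apply/seteqP; split => [|y /=].
  have /closure_id -> : closed (`[-1, 1]%classic : set R) by exact: itv_closed.
  by apply: closureS => _ [s _ <-] /=; rewrite in_itv /= cos_geN1 cos_le1.
rewrite in_itv /= => y1 B By.
have yE : cos (acos y) = y by rewrite acosK.
have : nbhs (acos y) (cos @^-1` B) by apply: (@continuous_cos R (acos y)); rewrite yE.
case/nbhs_ballP => e /= e0 He.
have e1 : 0 < e / (2 * pi) by rewrite divr_gt0// mulr_gt0.
have [s [m sm]] := kronecker ((acos y - be) / (2 * pi)) irr e1.
exists (cos (al * s%:~R + be)); split; first by exists s.
rewrite -(@cosD2zpi _ (- m)); apply: He; rewrite /ball /=.
have -> : acos y - (al * s%:~R + be + (- m)%:~R * (2 * pi)) =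
    - ((s%:~R * (al / (2 * pi)) - m%:~R - (acos y - be) / (2 * pi)) * (2 * pi)).
  by rewrite mulrNz; have := lt0r_neq0 pi0; move: (acos y) (pi : R) => ? p p0; field.
rewrite normrN normrM [`|2 * pi|]gtr0_norm ?mulr_gt0//.
by rewrite -ltr_pdivlMr// mulr_gt0.
Qed.

End IrrationalRotation.

(** * Fourier series of dn and cn *)

Lemma bilateral_sum_geometric (R : realType) (c : int -> R) (M r : R) : 0 <= r -> r < 1 ->
  (forall n : nat, `|c n%:Z| <= M * r ^+ n) ->
  (forall n : nat, `|c (- n.+1%:Z)| <= M * r ^+ n) -> exists l, bilateral_sum c l.
Proof.
move=> r0 r1 c1 c2.
have cvg_side (u : nat -> R) : (forall n, `|u n| <= M * r ^+ n) -> cvgn (series u).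
  move=> hu; apply: normed_cvg.
  apply: (@series_le_cvg _ _ (geometric M r)) => //.
  - by move=> n; rewrite /= normr_ge0.
  - by move=> n; exact: le_trans (normr_ge0 _) (hu n).
  - by apply: is_cvg_geometric_series; rewrite ger0_norm.
have h1 := cvg_side (fun s : nat => c s%:Z) c1.
have h2 := cvg_side (fun s : nat => c (- s.+1%:Z)) c2.
by exists (limn (series (fun s : nat => c s%:Z)) + limn (series (fun s : nat => c (- s.+1%:Z)))),
  (limn (series (fun s : nat => c s%:Z))), (limn (series (fun s : nat => c (- s.+1%:Z)))).
Qed.

Section FourierSeries.
Variables (R : realType) (k : R).
Hypotheses (k_gt0 : 0 < k) (k_lt1 : k < 1).
Local Notation F := (ellipticF k).
Local Notation K := (ellipticK k).
Local Notation K' := (ellipticK (Num.sqrt (1 - k ^+ 2))).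
Local Notation q := (nome k).
Local Notation am := (jacobi_am k).

Let K_gt0 : 0 < K := ellipticK_gt0 k_gt0 k_lt1.
Let K'_gt0 : 0 < K' := ellipticK_gt0 (compl_gt0 k_gt0 k_lt1) (compl_lt1 k_gt0).

Lemma nome_gt0 : 0 < q. Proof. exact: expR_gt0. Qed.

Lemma nome_lt1 : q < 1.
Proof.
rewrite /nome -[ltRHS]expR0 ltr_expR mulNr mulNr oppr_lt0.
by rewrite divr_gt0// mulr_gt0// pi_gt0.
Qed.

Lemma nome_powR x : q `^ x = expR (- (x * (pi / K) * K')).
Proof.
rewrite /powR gt_eqF ?nome_gt0// /nome expRK; congr expR; ring.
Qed.

(** 2 cosh (pi x K' / K), by [cosh2E]. *)
Definition cosh2 x := q `^ x + q `^ (- x).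

Lemma cosh2_gt0 x : 0 < cosh2 x.
Proof. by rewrite addr_gt0// powR_gt0// nome_gt0. Qed.

Lemma cosh2E x : cosh2 x = expR (x * (pi / K) * K') + expR (- (x * (pi / K) * K')).
Proof. by rewrite /cosh2 !nome_powR addrC; congr (expR _ + _); ring. Qed.

Lemma cosh2_bound o (n : nat) :
  (cosh2 (n%:R + o))^-1 <= q `^ o * q ^+ n /\ (cosh2 (- n.+1%:R + o))^-1 <= q `^ (- o) * q ^+ n.
Proof.
have bnd x y : q `^ x <= cosh2 y -> (cosh2 y)^-1 <= q `^ (- x).
  by rewrite powRN lef_pV2 ?posrE ?cosh2_gt0 ?powR_gt0// nome_gt0.
split.
  rewrite -powR_mulrn ?(ltW nome_gt0)// -powRD; last by rewrite (gt_eqF nome_gt0) implybT.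
  rewrite (addrC o) -[X in q `^ X]opprK; apply: bnd.
  by rewrite /cosh2 lerDr powR_ge0.
apply: (@le_trans _ _ (q `^ (- o) * q ^+ n.+1)).
  rewrite -powR_mulrn ?(ltW nome_gt0)// -powRD; last by rewrite (gt_eqF nome_gt0) implybT.
  have -> : - o + n.+1%:R = - (- n.+1%:R + o) by rewrite opprD opprK addrC.
  apply: bnd.
  by rewrite /cosh2 lerDl powR_ge0.
by rewrite ler_wpM2l ?powR_ge0// exprS ler_piMl ?exprn_ge0 ?(ltW nome_gt0) ?(ltW nome_lt1).
Qed.

Definition fourier_term C o u (s : int) : R :=
  C * (1 / cosh2 (s%:~R + o)) * cos ((s%:~R + o) * (pi / K) * u).

(** The Fourier series of [f] in the variable F phi, with frequencies in the integers
    shifted by [o]; the coefficients decay geometrically. *)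
Lemma bilateral_fourier f C o phi0 : continuous f -> (forall x, f (- x) = f x) ->
  - (pi / 2) < phi0 -> phi0 < pi / 2 ->
  (forall s : int, fourier_coef k f (s%:~R + o) = 2 * K * C / cosh2 (s%:~R + o)) ->
  bilateral_sum (fourier_term C o (F phi0)) (f phi0).
Proof.
move=> cf fN p1 p2 coefE.
have q0 := ltW nome_gt0.
have hb (s : int) : `|fourier_term C o (F phi0) s| <= `|C| * (cosh2 (s%:~R + o))^-1.
  rewrite /fourier_term div1r !normrM normfV (gtr0_norm (cosh2_gt0 _)) -[leRHS]mulr1.
  by rewrite ler_wpM2l ?mulr_ge0 ?invr_ge0 ?(ltW (cosh2_gt0 _))// ler_norml cos_geN1 cos_le1.
have M0 : `|C| * q `^ o <= `|C| * (q `^ o + q `^ (- o)).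
  by rewrite ler_wpM2l// lerDl powR_ge0.
have M1 : `|C| * q `^ (- o) <= `|C| * (q `^ o + q `^ (- o)).
  by rewrite ler_wpM2l// lerDr powR_ge0.
have [l hl] : exists l, bilateral_sum (fourier_term C o (F phi0)) l.
  apply: (bilateral_sum_geometric (M := `|C| * (q `^ o + q `^ (- o))) q0 nome_lt1) => n.
    apply: le_trans (hb _) _; rewrite -pmulrn.
    apply: le_trans (ler_wpM2l (normr_ge0 C) (cosh2_bound o n).1) _.
    by rewrite mulrA ler_wpM2r// exprn_ge0.
  apply: le_trans (hb _) _; rewrite mulrNz -pmulrn.
  apply: le_trans (ler_wpM2l (normr_ge0 C) (cosh2_bound o n).2) _.
  by rewrite mulrA ler_wpM2r// exprn_ge0.
have h2 := bilateral_sumZ (2 * K) hl.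
have := @fourier_inversion _ _ k_gt0 k_lt1 f o phi0 cf fN p1 p2 (2 * K * l).
have -> : (fun s : int => fourier_coef k f (s%:~R + o) *
     cos ((s%:~R + o) * (pi / K) * F phi0)) = (fun s => 2 * K * fourier_term C o (F phi0) s).
  by apply/funext => s; rewrite coefE /fourier_term; ring.
move=> /(_ h2) /mulfI <-//.
by rewrite mulf_neq0// gt_eqF.
Qed.

Lemma shift_ind (P : R -> Prop) d : (forall u, P u -> P (u + d)) -> (forall u, P u -> P (u - d)) ->
  forall (m : int) u, P u -> P (u + m%:~R * d).
Proof.
move=> Pp Pm m u Pu; case: m => n.
  elim: n => [|n IH]; first by rewrite mul0r addr0.
  by rewrite -pmulrn -natr1 mulrDl mul1r addrA; exact: Pp.
elim: n => [|n IH]; first by rewrite NegzE mulrNz mulN1r; exact: Pm.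
move: IH; rewrite !NegzE !mulrNz -!pmulrn => IH.
by rewrite -[n.+2%:R]natr1 opprD mulrDl mulN1r addrA; exact: Pm.
Qed.

Lemma modulo_2K u : exists m : int, - K <= u - m%:~R * (2 * K) < K.
Proof.
exists (Num.floor ((u + K) / (2 * K))).
have K2 : 0 < 2 * K by rewrite mulr_gt0.
have := floor_le ((u + K) / (2 * K)); have := floorD1_gt ((u + K) / (2 * K)).
rewrite rmorphD /= ltr_pdivrMr// ler_pdivlMr// mulrDl mul1r => h1 h2.
by apply/andP; split; lra.
Qed.

Lemma am_itv u : - K < u -> u < K -> - (pi / 2) < am u /\ am u < pi / 2.
Proof.
move=> u1 u2; split; rewrite ltNge; apply/negP => h.
  have := ellipticF_ler k_gt0 k_lt1 h.
  rewrite (ellipticFN k_gt0 k_lt1) ellipticF_pihalf (jacobi_amK k_gt0 k_lt1); lra.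
have := ellipticF_ler k_gt0 k_lt1 h.
rewrite ellipticF_pihalf (jacobi_amK k_gt0 k_lt1); lra.
Qed.

(** Both sides are multiplied by [eps] when [u] increases by [2 * K], which reduces [u]
    to the open interval from - K to K, where [bilateral_fourier] applies. *)
Lemma bilateral_fourier_periodic f (X : R -> R) C o eps u :
  continuous f -> (forall x, f (- x) = f x) -> (forall v, X v = f (am v)) ->
  (forall s : int, fourier_coef k f (s%:~R + o) = 2 * K * C / cosh2 (s%:~R + o)) ->
  (forall (s : int) y, cos (y + (s%:~R + o) * (2 * pi)) = eps * cos y) -> eps * eps = 1 ->
  (forall v, X (v + 2 * K) = eps * X v) ->
  (forall m : int, u - m%:~R * (2 * K) != - K) ->
  bilateral_sum (fourier_term C o u) (X u).
Proof.
move=> cf fN XE coefE epsE eps2 XD uK.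
have [m /andP[m1 m2]] := modulo_2K u.
have {}m1 : - K < u - m%:~R * (2 * K) by rewrite lt_neqAle eq_sym uK.
rewrite -(subrK (m%:~R * (2 * K)) u).
have argE s v : (s%:~R + o) * (pi / K) * (v + 2 * K) =
    (s%:~R + o) * (pi / K) * v + (s%:~R + o) * (2 * pi).
  by have := lt0r_neq0 K_gt0; move: (K) (pi : R) => a p a0; field.
apply: (@shift_ind (fun v => bilateral_sum (fourier_term C o v) (X v))).
- move=> v hv; rewrite XD; apply: eq_bilateral_sum (bilateral_sumZ eps hv) => s.
  by rewrite /fourier_term argE epsE; ring.
- move=> v hv; have -> : X (v - 2 * K) = eps * X v.
    by rewrite -{2}(subrK (2 * K) v) XD mulrA eps2 mul1r.
  apply: eq_bilateral_sum (bilateral_sumZ eps hv) => s.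
  by rewrite /fourier_term -{1}(subrK (2 * K) v) argE epsE; ring: eps2.
have [a1 a2] := am_itv m1 m2.
rewrite XE -{1}(jacobi_amK k_gt0 k_lt1 (u - _)).
exact: bilateral_fourier.
Qed.

End FourierSeries.

(** * Moments and conclusion *)

Lemma irrational_quarter (R : realType) (x : R) : irrational x -> irrational (x / 4).
Proof.
move=> irr [r _ e]; apply: irr; exists (4 * r) => //.
by rewrite rmorphM /= e ratr_nat; field.
Qed.

Section Moments.
Variables (R : realType) (k w : R).
Hypotheses (k_gt0 : 0 < k) (k_lt1 : k < 1) (w_irr : irrational (w / ellipticK k)).
Local Notation K := (ellipticK k).
Local Notation sn := (jacobi_sn k).
Local Notation cn := (jacobi_cn k).
Local Notation dn := (jacobi_dn k).
Local Notation om := (pi / K).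

Let K_gt0 : 0 < K := ellipticK_gt0 k_gt0 k_lt1.

Lemma multiple_neq (j m : int) : j%:~R * w = m%:~R * K -> j = 0.
Proof.
move=> e; apply/eqP/negPn/negP => j0; apply: (@irrational_intr _ _ j m w_irr j0).
by rewrite mulrA e mulfK// gt_eqF.
Qed.

Lemma multiple_neq_halfperiod (j m : int) : j%:~R * w - m%:~R * (2 * K) != - K.
Proof.
apply/negP => /eqP e.
have e2 : j%:~R * w = (2 * m - 1)%:~R * K.
  by rewrite rmorphB rmorphM /=; move: e; lra.
have j0 := multiple_neq e2; move: e2; rewrite j0 mul0r => /esym/eqP.
by rewrite mulf_eq0 (gt_eqF K_gt0) orbF intr_eq0; lia.
Qed.

(** The real zeros of sn are the multiples of 2 K.  Since cn^2 + sn^2 = 1 and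
    dn^2 + k^2 sn^2 = 1, no reflection parameter equals 1. *)
Lemma sn_multiple_neq0 (n : nat) : sn (n.+1%:R * w) != 0.
Proof.
apply/negP => /eqP s0; set u := n.+1%:R * w in s0.
have [m /andP[m1 m2]] := modulo_2K k_gt0 k_lt1 u.
have snD v : sn (v + 2 * K) = - sn v.
  by rewrite /jacobi_sn (amD2K k_gt0 k_lt1) sinDpi.
have : sn (u + (- m)%:~R * (2 * K)) = 0.
  apply: (@shift_ind _ (fun v => sn v = 0)) => // v hv; first by rewrite snD hv oppr0.
  by apply/eqP; rewrite -oppr_eq0 -snD subrK hv.
have {}m1 : - K < u - m%:~R * (2 * K).
  by rewrite lt_neqAle eq_sym m1 /u pmulrn multiple_neq_halfperiod.
have [a1 a2] := am_itv k_gt0 k_lt1 m1 m2.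
rewrite mulrNz mulNr /jacobi_sn -[RHS]sin0 => /sin_inj.
rewrite !in_itv /= !(ltW a1) !(ltW a2) => /(_ isT) am0'.
have pi0 := pi_gt0 R.
have /am0' am0 : - (pi / 2) <= (0 : R) <= pi / 2 by apply/andP; split; lra.
have := jacobi_amK k_gt0 k_lt1 (u - m%:~R * (2 * K)); rewrite am0 ellipticF0 => /esym u0.
suff : n.+1%:Z = 0 by [].
apply: (@multiple_neq _ (2 * m)); rewrite -pmulrn rmorphM /= -/u; lra.
Qed.

Lemma cn_multiple_neq (n : nat) e : e ^+ 2 = 1 -> cn (n.+1%:R * w) != e.
Proof.
move=> e2; apply/negP => /eqP c1.
have /eqP := cn_sqr k (n.+1%:R * w); rewrite c1 e2 eq_sym -subr_eq0 addrAC subrr sub0r oppr_eq0.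
by rewrite sqrf_eq0 (negPf (sn_multiple_neq0 n)).
Qed.

Lemma dn_multiple_neq1 (n : nat) : dn (n.+1%:R * w) != 1.
Proof.
apply/negP => /eqP c1.
have /eqP := dn_sqr k_gt0 k_lt1 (n.+1%:R * w).
rewrite c1 expr1n eq_sym -subr_eq0 addrAC subrr sub0r oppr_eq0 mulf_eq0 !sqrf_eq0.
by rewrite (gt_eqF k_gt0) (negPf (sn_multiple_neq0 n)).
Qed.

Lemma sin_intpi (s : int) : sin (s%:~R * pi) = 0 :> R.
Proof.
have sin_natpi (n : nat) : sin (n%:R * pi) = 0 :> R.
  by rewrite -[n%:R * pi]add0r sinDnpi sin0 mulr0.
case: s => n; first exact: sin_natpi.
by rewrite NegzE mulrNz mulNr sinN sin_natpi oppr0.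
Qed.

Lemma moment_dn (j : int) :
  bilateral_sum (fourier_term k om 0 (j%:~R * w)) (dn (j%:~R * w)).
Proof.
apply: (bilateral_fourier_periodic k_gt0 k_lt1 (f := Delta k) (eps := 1)).
- exact: (der_continuous (der_Delta k_gt0 k_lt1)).
- by move=> x; rewrite /Delta sinN sqrrN.
- by [].
- move=> s; rewrite addr0 cosh2E.
  rewrite (_ : 2 * K * om = 2 * pi); last by rewrite -mulrA [K * _]mulrC divfK// gt_eqF.
  rewrite -fourier_dn//; last by rewrite -mulrA divfK ?gt_eqF// sin_intpi.
  by apply: eq_Rintegral => phi _; rewrite divff ?Delta_neq0// mul1r.
- by move=> s y; rewrite addr0 cosD2zpi mul1r.
- by rewrite mulr1.
- by move=> v; rewrite (dnD2K k_gt0 k_lt1) mul1r.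
- by move=> m; exact: multiple_neq_halfperiod.
Qed.

Lemma moment_cn (j : int) :
  bilateral_sum (fourier_term k (pi / (k * K)) (- 2^-1) (j%:~R * w)) (cn (j%:~R * w)).
Proof.
apply: (bilateral_fourier_periodic k_gt0 k_lt1 (f := cos) (eps := -1)).
- exact: continuous_cos.
- by move=> x; rewrite cosN.
- by [].
- move=> s; rewrite cosh2E.
  rewrite (_ : 2 * K * (pi / (k * K)) = 2 * pi / k); last first.
    by have := lt0r_neq0 K_gt0; have := lt0r_neq0 k_gt0; move: K (pi : R) => a p k0 a0; field; rewrite k0.
  rewrite -mulrA -invfM -fourier_cn//.
  rewrite -mulrA divfK ?gt_eqF// mulrBl [2^-1 * pi]mulrC.
  by rewrite cosBpihalf sin_intpi.
- move=> s y; have -> : y + (s%:~R - 2^-1) * (2 * pi) = (y - pi) + s%:~R * (2 * pi) by field.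
  by rewrite cosD2zpi mulN1r -[in RHS](subrK pi y) cosDpi opprK.
- by rewrite mulrNN mulr1.
- by move=> v; rewrite (cnD2K k_gt0 k_lt1) mulN1r.
- by move=> m; exact: multiple_neq_halfperiod.
Qed.

End Moments.

Lemma angle_irrational (R : realType) (k w : R) : 0 < k -> k < 1 -> irrational (w / ellipticK k) ->
  irrational (pi * w / (2 * ellipticK k) / (2 * pi)).
Proof.
move=> k0 k1 /irrational_quarter; congr irrational.
have := lt0r_neq0 (ellipticK_gt0 k0 k1); have := lt0r_neq0 (pi_gt0 R).
move: (ellipticK k) (pi : R) => K p p0 K0; field.
by rewrite K0 p0.
Qed.

(** Both cases of the theorem have this form, with the roles of cn and dn exchanged. *)
Lemma parity_unify (R : realType) (a : nat -> R) (X Y : R -> R) w :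
  (forall n, a (2 * n)%N = X (w * (2 * n + 1)%:R)) ->
  (forall n, a (2 * n + 1)%N = - Y (w * (2 * n + 2)%:R)) ->
  forall n, a n = (-1) ^+ n * (if odd n then Y else X) (n.+1%:R * w).
Proof.
move=> a0 a1 n; rewrite -signr_odd -(odd_double_half n) -mul2n oddD oddM /= addbF oddb.
case: (odd n); last by rewrite add0n a0 expr0 mul1r addn1 mulrC.
by rewrite addnC a1 expr1 mulN1r mulrC -addnS.
Qed.

Theorem mainTheorem5 (R : realType) (k w : R) (k_gt0 : 0 < k) (k_lt1 : k < 1)
    (w_irr : irrational (w / ellipticK k)) :
  let K := ellipticK k in
  let q := nome k in
  let conclusion (a : nat -> R) (x rho : int -> R) :=
    let S := szegoS a in
    (forall n m : nat,
      bilateral_sum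
        (fun s : int =>
          ((S n).[x s] * (S m).[x s] + (S n).[- x s] * (S m).[- x s]) / 2 * rho s)
        (kappa a n * (n == m)%:R))
    /\ closure (range x) = `[-1, 1]%classic in
  (forall a : nat -> R,
    (forall n : nat, a (2 * n)%N = jacobi_cn k (w * (2 * n + 1)%:R)) ->
    (forall n : nat, a (2 * n + 1)%N = - jacobi_dn k (w * (2 * n + 2)%:R)) ->
    conclusion a
      (fun s : int => cos (pi * w * (s%:~R - 2^-1) / (2 * K)))
      (fun s : int => pi / (k * K) *
        (1 / (q `^ (s%:~R - 2^-1) + q `^ (- s%:~R + 2^-1)))))
  /\
  (forall a : nat -> R,
    (forall n : nat, a (2 * n)%N = jacobi_dn k (w * (2 * n + 1)%:R)) ->
    (forall n : nat, a (2 * n + 1)%N = - jacobi_cn k (w * (2 * n + 2)%:R)) ->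
    conclusion a
      (fun s : int => cos (pi * w * s%:~R / (2 * K)))
      (fun s : int => pi / K * (1 / (q `^ s%:~R + q `^ (- s%:~R))))).
Proof.
move=> K q conclusion.
have K_gt0 : 0 < K := ellipticK_gt0 k_gt0 k_lt1.
have angles := angle_irrational k_gt0 k_lt1 w_irr.
split=> a aX aY; split.
- move=> n m.
  pose X b := if b then jacobi_dn k else jacobi_cn k.
  pose g (b : bool) := if b then k ^+ 2 else 1.
  pose theta (s : int) := pi * w * (s%:~R - 2^-1) / K.
  pose rho (s : int) := pi / (k * K) * (1 / cosh2 k (s%:~R - 2^-1)).
  have XD b u v :
      X b (u + v) = X b u * X b v - g b * jacobi_sn k u * jacobi_sn k v * X (~~ b) (u + v).
    by case: b; rewrite /X /g /= ?mul1r; [exact: dnD|exact: cnD].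
  have aE := parity_unify aX aY.
  have a_neq1 i : aprev a i != 1.
    case: i => [|i] /=; first by rewrite eq_sym -addr_eq0.
    rewrite aE -signr_odd; case: (odd i).
      by rewrite expr1 mulN1r lt_eqF// (lt_trans _ ltr01)// oppr_lt0 dn_gt0.
    by rewrite expr0 mul1r; apply: (cn_multiple_neq k_gt0 k_lt1 w_irr); rewrite expr1n.
  have mom (j : int) :
      bilateral_sum (fun s => rho s * cos (j%:~R * theta s)) (X false (j%:~R * w)).
    apply: eq_bilateral_sum (moment_cn k_gt0 k_lt1 w_irr j) => s.
    by rewrite /fourier_term /rho /theta -/K; congr (_ * cos _); ring.
  have := @szego_orthogonal _ (jacobi_sn k) X g w (sn0 k_gt0 k_lt1) (snN k_gt0 k_lt1) _ _ XD a
    aE a_neq1 theta rho mom n m.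
  have thE s : theta s / 2 = pi * w * (s%:~R - 2^-1) / (2 * K).
    by rewrite /theta invfM; ring.
  move=> H; apply: eq_bilateral_sum (H _ _) => [s|[]|[]].
  + by rewrite thE /rho /cosh2 opprB [2^-1 - _]addrC.
  + exact: dn0.
  + exact: cn0.
  + exact: dnN.
  + exact: cnN.
- have -> : (fun s : int => cos (pi * w * (s%:~R - 2^-1) / (2 * K))) =
      (fun s : int => cos (pi * w / (2 * K) * s%:~R + - (pi * w / (2 * K) * 2^-1))).
    by apply/funext => s; congr cos; ring.
  exact: dense_cos_orbit angles.
- move=> n m.
  pose X b := if b then jacobi_cn k else jacobi_dn k.
  pose g (b : bool) := if b then 1 else k ^+ 2.
  pose theta (s : int) := pi * w * s%:~R / K.
  pose rho (s : int) := pi / K * (1 / cosh2 k s%:~R).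
  have XD b u v :
      X b (u + v) = X b u * X b v - g b * jacobi_sn k u * jacobi_sn k v * X (~~ b) (u + v).
    by case: b; rewrite /X /g /= ?mul1r; [exact: cnD|exact: dnD].
  have aE := parity_unify aX aY.
  have a_neq1 i : aprev a i != 1.
    case: i => [|i] /=; first by rewrite eq_sym -addr_eq0.
    rewrite aE -signr_odd; case: (odd i).
      rewrite expr1 mulN1r eqr_oppLR; apply: (cn_multiple_neq k_gt0 k_lt1 w_irr).
      by rewrite sqrrN expr1n.
    by rewrite expr0 mul1r dn_multiple_neq1.
  have mom (j : int) :
      bilateral_sum (fun s => rho s * cos (j%:~R * theta s)) (X false (j%:~R * w)).
    apply: eq_bilateral_sum (moment_dn k_gt0 k_lt1 w_irr j) => s.
    by rewrite /fourier_term /rho /theta -/K addr0; congr (_ * cos _); ring.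
  have := @szego_orthogonal _ (jacobi_sn k) X g w (sn0 k_gt0 k_lt1) (snN k_gt0 k_lt1) _ _ XD a
    aE a_neq1 theta rho mom n m.
  have thE s : theta s / 2 = pi * w * s%:~R / (2 * K) by rewrite /theta invfM; ring.
  move=> H; apply: eq_bilateral_sum (H _ _) => [s|[]|[]].
  + by rewrite thE /rho /cosh2.
  + exact: cn0.
  + exact: dn0.
  + exact: cnN.
  + exact: dnN.
- have -> : (fun s : int => cos (pi * w * s%:~R / (2 * K))) =
      (fun s : int => cos (pi * w / (2 * K) * s%:~R + 0)).
    by apply/funext => s; congr cos; ring.
  exact: dense_cos_orbit angles.
Qed.
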